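(* Let $P$ be a rectangle with sides of length $1$ and $h$, $0<h\le1$, and let $f\in\mathcal R_1^k$, $k\ge1$, with $f'>0$. Suppose that $\tilde\theta>\max\{-\theta_*^-,\theta_*^+\}$. Then: (1) $\hat M$ is a forward invariant set, i.e. $\Phi_f(\hat M)\subset\hat M$; (2) every invariant subset of $\hat M$ is uniformly hyperbolic; (3) $B(\mathcal P)=T$.
   Context: Billiard map. Let $P\subset\mathbb R^2$ be the compact region bounded by a polygon with vertices $C_1,\dots,C_n$; let $\zeta:[0,|\partial P|]\to\mathbb R^2$ be the positively oriented arclength parametrization of $\partial P$, with $\zeta(\tilde s_i)=C_i$, $0=\tilde s_1<\dots<\tilde s_n<\tilde s_{n+1}=|\partial P|$ and $\zeta(|\partial P|)=\zeta(0)$. Put $M=(0,|\partial P|)\times(-\pi/2,\pi/2)$ and $V=\{\tilde s_1,\dots,\tilde s_{n+1}\}\times(-\pi/2,\pi/2)$. For $x=(s,\theta)\in M\setminus V$ let $q(x)=\zeta(s)$, let $v(x)$ be the unit vector such that the oriented angle from $\zeta'(s)$ to $v(x)$ is $\pi/2-\theta$, let $t(x)=\sup\{\tau>0: (q(x),q(x)+\tau v(x))\subset P\}$ (open segment), and $q_1(x)=q(x)+t(x)v(x)$. Let $S_1^+=\bigcup_i\overline{q_1^{-1}(C_i)}$ and $N_1^+=\partial M\cup V\cup S_1^+$. For $x\in M\setminus N_1^+$ let $s_1(x)=\zeta^{-1}(q_1(x))$, $\bar v_1(x)=-v(x)+2\langle\zeta'(s_1(x)),v(x)\rangle\zeta'(s_1(x))$,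 $\bar\theta_1(x)=\arcsin\langle\zeta'(s_1(x)),\bar v_1(x)\rangle$. The billiard map with reflection law $f:(-\pi/2,\pi/2)\to(-\pi/2,\pi/2)$ is $\Phi=\Phi_f:M\setminus N_1^+\to M$, $\Phi_f(x)=(s_1(x),f(\bar\theta_1(x)))$. Put $N_{j+1}^+=N_j^+\cup\Phi_f^{-1}(N_j^+)$, $N_\infty^+=\bigcup_{j\ge1}N_j^+$, $D=\bigcap_{j\ge0}\Phi_f^j(M\setminus N_\infty^+)$. A set $\Sigma$ is invariant if $\Sigma\subset D$ and $\Phi^{-1}(\Sigma)=\Sigma$. Reflection laws. $\lambda(f)=\sup_{(-\pi/2,\pi/2)}|f'|$; $\mathcal R_1^k$ is the set of $C^k$ embeddings $f:(-\pi/2,\pi/2)\to(-\pi/2,\pi/2)$ with $f(0)=0$ and $\lambda(f)<1$. Such $f$ is extended continuously to $[-\pi/2,\pi/2]$. Auxiliary quantities. $f_1(\theta)=-f(\theta)$ for $\theta\in[-\pi/2,\pi/2]$; $f_2(\theta)=f\left(\operatorname{sgn}(\theta)\frac\pi2-\theta\right)$ for $\theta\in[-\pi/2,0)\cup(0,\pi/2]$. $\theta_*^-<0<\theta_*^+$ are the two solutions in $(-\pi/2,\pi/2)$ of $\sum_{n=0}^\infty\tan(|f_1^n(\theta)|)=1/h$. $\tilde\theta=\min\{f_2(f(\pi/2)),\,-f_2(f(-\pi/2))\}$. $T$ is the set of $x\in M\setminus N_\infty^+$ whose positive semi-trajectory is trapped between two parallel sides of $P$ (all its collisions occur at one pair of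 parallel sides); $\hat M=M\setminus(T\cup N_\infty^+)$. $\mathcal P$ is the set of periodic points of $\Phi$ of period two, and $B(\mathcal P)$, its basin of attraction, is the set of $x\in M\setminus N_\infty^+$ with $d(\Phi^n(x),\mathcal P)\to0$ as $n\to+\infty$ (Euclidean distance). An invariant set $\Sigma$ is uniformly hyperbolic if there are a non-trivial continuous ($D\Phi$-invariant) splitting $T_\Sigma M=E\oplus F$ and constants $0<\mu<1$, $A>0$ with $\|D\Phi^n|_{E(x)}\|\le A\mu^n$ and $\|D\Phi^{-n}|_{F(\Phi^nx)}\|\le A\mu^n$ for all $x\in\Sigma$, $n\ge1$ (Euclidean norm in the coordinates $(s,\theta)$). *)

(* Defs.v *)
From HB Require Import structures.
From mathcomp Require Import all_boot all_order all_algebra.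
From mathcomp Require Import all_classical all_reals all_analysis.

Set Implicit Arguments.
Unset Strict Implicit.
Unset Printing Implicit Defensive.

Import Order.TTheory GRing.Theory Num.Theory.
Import numFieldNormedType.Exports.
Local Open Scope classical_set_scope.
Local Open Scope ring_scope.

(* The plane and the (s, theta) phase space are both (R * R)%type.  Its library
   norm is the max norm, hence the Euclidean norm [enorm]; the topology,
   continuity and differentiability are the same for both norms. *)
Section Plane.
Context {R : realType}.
Implicit Types u v : (R * R)%type.

Definition dotp u v : R := u.1 * v.1 + u.2 * v.2.
Definition crossp u v : R := u.1 * v.2 - u.2 * v.1.
Definition enorm u : R := Num.sqrt (dotp u u).
Definition rot (a : R) u : R * R :=
  (cos a * u.1 - sin a * u.2, sin a * u.1 + cos a * u.2).

Definition open_segment u v : set (R * R) :=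
  [set u + r *: (v - u) | r in [set r : R | 0 < r < 1]].

Definition eucl_dist (x : R * R) (A : set (R * R)) : \bar R :=
  ereal_inf [set (enorm (x - a))%:E | a in A].

Definition is_line (L : set (R * R)) : Prop :=
  exists2 e : R * R, e != 0 & L = [set a *: e | a in [set: R]].

End Plane.

Section ReflectionLaw.
Context {R : realType}.
Implicit Types f : R -> R.

Definition Iangle : set R := [set a : R | - (pi / 2) < a < pi / 2].

(* Laws are total functions of which only the restriction to [Iangle] matters;
   [Iangle] being open, so do the derivatives at its points. *)
Definition Ck_on_Iangle (k : nat) f : Prop :=
  (forall j, (j < k)%N -> forall a, Iangle a -> derivable (derive1n j f) a 1) /\
  (forall a, Iangle a -> {for a, continuous (derive1n k f)}).

Definition embedding_on_Iangle f : Prop :=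
  (forall a, Iangle a -> derive1 f a != 0) /\
  (exists g : R -> R, (forall a, Iangle a -> g (f a) = a) /\
     {within f @` Iangle, continuous g}).

(* Extended-real valued, so that an unbounded derivative gives +oo. *)
Definition lambda f : \bar R := ereal_sup [set (`|derive1 f a|)%:E | a in Iangle].

Definition reflection_law (k : nat) f : Prop :=
  [/\ forall a, Iangle a -> Iangle (f a),
      Ck_on_Iangle k f,
      embedding_on_Iangle f,
      f 0 = 0
    & (lambda f < 1%:E)%E].

Definition fext f (a : R) : R :=
  if a == pi / 2 then lim (f x @[x --> (pi / 2)^'-])
  else if a == - (pi / 2) then lim (f x @[x --> (- (pi / 2))^'+])
  else f a.

Definition f1 f (a : R) : R := - fext f a.
Definition f2 f (a : R) : R := fext f (Num.sg a * (pi / 2) - a).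

Definition solves_tan_series f (h a : R) : Prop :=
  series (fun n => tan `|iter n (f1 f) a|) @ \oo --> h^-1.

Definition theta_tilde f : R :=
  Num.min (f2 f (fext f (pi / 2))) (- f2 f (fext f (- (pi / 2)))).

End ReflectionLaw.

Section Polygon.
Context {R : realType} {n : nat}.
Variable C : 'I_n.+1 -> (R * R)%type.

Definition side (i : 'I_n.+1) : R * R := C (ordS i) - C i.
Definition corner (i : nat) : R := \sum_(j < n.+1 | (j < i)%N) enorm (side j).
Definition perimeter : R := corner n.+1.

(* The coefficient of side i is the fraction of that side covered by the arc of
   length s starting at the initial vertex. *)
Definition zeta (s : R) : R * R :=
  C ord0 + \sum_(i < n.+1) (Num.min (Num.max (s - corner i) 0) (enorm (side i))
                 / enorm (side i)) *: side i.

Definition hull : set (R * R) :=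
  [set p | exists w : 'I_n.+1 -> R,
     [/\ forall i, 0 <= w i, \sum_i w i = 1 & p = \sum_i w i *: C i]].

End Polygon.

(* Vertices in counterclockwise order. *)
Definition is_rectangle {R : realType} (C : 'I_4 -> (R * R)%type) (a b : R) :=
  let i0 := inord 0 : 'I_4 in let i1 := inord 1 : 'I_4 in
  let i2 := inord 2 : 'I_4 in let i3 := inord 3 : 'I_4 in
  [/\ C i1 - C i0 = C i2 - C i3,
      dotp (C i1 - C i0) (C i2 - C i1) = 0,
      0 < crossp (C i1 - C i0) (C i2 - C i1),
      enorm (C i1 - C i0) = a
    & enorm (C i2 - C i1) = b].

(* The billiard in the region P bounded by the polygon with vertices C, with
   reflection law f.  Partial maps are totalised: q1 is meaningful on M `\` V
   and Phi on [dom], and preimages are intersected with these domains. *)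
Section Billiard.
Context {R : realType} {n : nat}.
Variables (C : 'I_n.+1 -> (R * R)%type) (P : set (R * R)) (f : R -> R).
Implicit Types (x : (R * R)%type) (S : set (R * R)).

Definition M : set (R * R) :=
  [set x | 0 < x.1 < perimeter C /\ Iangle x.2].
Definition V : set (R * R) :=
  [set x | (exists2 i, (i <= n.+1)%N & x.1 = corner C i) /\ Iangle x.2].

Definition q x : R * R := zeta C x.1.
Definition v x : R * R := rot (pi / 2 - x.2) (derive1 (zeta C) x.1).
Definition t x : R :=
  sup [set tau : R | 0 < tau /\ open_segment (q x) (q x + tau *: v x) `<=` P].
Definition q1 x : R * R := q x + t x *: v x.

Definition S1 : set (R * R) :=
  \bigcup_(i : 'I_n.+1) closure ((M `\` V) `&` q1 @^-1` [set C i]).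
Definition N1 : set (R * R) := (closure M `\` interior M) `|` V `|` S1.
Definition dom : set (R * R) := M `\` N1.

Definition s1 x : R :=
  xget 0 [set s | 0 < s < perimeter C /\ zeta C s = q1 x].
Definition vbar1 x : R * R :=
  let tau := derive1 (zeta C) (s1 x) in - v x + (2 * dotp tau (v x)) *: tau.
Definition thetabar1 x : R := asin (dotp (derive1 (zeta C) (s1 x)) (vbar1 x)).
Definition Phi x : R * R := (s1 x, f (thetabar1 x)).

Definition Phi_preimage S : set (R * R) := dom `&` Phi @^-1` S.

(* The sequence is indexed from 0: [N j] is N_{j+1}^+. *)
Fixpoint N (j : nat) : set (R * R) :=
  if j is j'.+1 then N j' `|` Phi_preimage (N j') else N1.
Definition Ninf : set (R * R) := \bigcup_j N j.

Definition D : set (R * R) := \bigcap_j (iter j Phi @` (M `\` Ninf)).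

Definition invariant_set S : Prop := S `<=` D /\ Phi_preimage S = S.

Definition on_side (i : 'I_n.+1) x : Prop := corner C i <= x.1 <= corner C i.+1.

(* The collisions of the positive semi-trajectory of x are those at the points
   q (Phi^m x) with m >= 1; x itself records the state from which the particle
   is launched, and the side carrying q x is not constrained. *)
Definition T : set (R * R) :=
  [set x | (M `\` Ninf) x /\
     exists i j : 'I_n.+1, [/\ i != j, crossp (side C i) (side C j) = 0
       & forall m, (0 < m)%N ->
           on_side i (iter m Phi x) \/ on_side j (iter m Phi x)]].

Definition Mhat : set (R * R) := M `\` (T `|` Ninf).

Definition period2 : set (R * R) :=
  [set x | [/\ dom x, dom (Phi x), Phi (Phi x) = x & Phi x != x]].

Definition basin S : set (R * R) :=
  [set x | (M `\` Ninf) x /\ (fun m => eucl_dist (iter m Phi x) S) @ \oo --> 0%E].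

(* A field of lines on S is continuous when near each point of S it is spanned
   by a nonvanishing vector field continuous at that point relative to S. *)
Definition continuous_line_field S (E : R * R -> set (R * R)) : Prop :=
  forall x, S x -> exists e : R * R -> R * R,
    (\forall y \near within S (nbhs x),
        e y != 0 /\ E y = [set a *: e y | a in [set: R]]) /\
    (e y @[y --> within S (nbhs x)] --> e x).

(* M is two-dimensional, so both summands of a non-trivial splitting are lines.
   D(Phi^-m) at Phi^m x is the inverse of the bijection D(Phi^m) at x, so its
   argument in F (Phi^m x) is written as 'd (Phi^m) x w. *)
Definition uniformly_hyperbolic S : Prop :=
  (forall x, S x -> forall m,
     differentiable (iter m Phi) x /\ bijective ('d (iter m Phi) x)) /\
  exists E F : R * R -> set (R * R),
    [/\ forall x, S x -> is_line (E x) /\ is_line (F x),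
        forall x, S x -> E x `&` F x = [set 0] /\
          (forall w, exists w1 w2, [/\ E x w1, F x w2 & w = w1 + w2]),
        continuous_line_field S E /\ continuous_line_field S F,
        forall x, S x ->
          'd Phi x @` E x = E (Phi x) /\ 'd Phi x @` F x = F (Phi x)
      & exists mu A : R, [/\ 0 < mu < 1, 0 < A
          & forall x m, S x -> (0 < m)%N ->
              (forall w, E x w ->
                 enorm ('d (iter m Phi) x w) <= A * mu ^+ m * enorm w) /\
              (forall w, F (iter m Phi x) ('d (iter m Phi) x w) ->
                 enorm w <= A * mu ^+ m * enorm ('d (iter m Phi) x w))]].

End Billiard.

(* Main.v *)
Require Import Defs.
From mathcomp Require Import all_boot all_order all_algebra.
From mathcomp Require Import all_classical all_reals all_analysis.
From mathcomp Require Import ring lra.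
Set Implicit Arguments.
Unset Strict Implicit.
Unset Printing Implicit Defensive.
Import Order.TTheory GRing.Theory Num.Theory.
Import numFieldNormedType.Exports.
Local Open Scope classical_set_scope.
Local Open Scope ring_scope.

(** The billiard map of a rectangle has three branches on each side: the ray
    reaches the opposite side, or the side to the right, or the side to the
    left.  On each branch the incoming angle is an affine function of the
    outgoing angle alone, so that the differential of [Phi] is triangular:
    it maps (ds, dtheta) to (a ds + b dtheta, c dtheta), with
    |a| = cos theta / cos thetabar and |c| = f'(thetabar) <= l < 1
    ([is_diff_Phi], [slope_norm]).

    All three claims follow from one escape argument.  Angles after a
    collision lie strictly between f(-pi/2) and f(pi/2), and a passage between
    adjacent sides replaces theta by f(+-pi/2 - theta); hence the angle after
    such a passage exceeds [theta_tilde] in absolute value ([adjacent_turn]).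
    During a run of bounces between two parallel sides of length len at
    distance w, the particle drifts along the sides in a constant direction,
    by w tan |theta_n| at the n-th bounce, and up to sign the theta_n are the
    iterates of [f1].  As theta_tilde is larger than |theta_*|, where the
    tangents of the iterates sum to exactly 1/h, finitely many terms of the
    sum started beyond theta_tilde already exceed 1/h >= len / w, and their
    number is uniform ([escape]).  So a run that follows a passage between
    adjacent sides has bounded length ([across_run_escapes]).

    Forward invariance: if the orbit of Phi x is trapped and that of x is not,
    then Phi x starts a passage between adjacent sides that is followed by an
    endless run ([trapped_pullback]).  Basin: the points of period two are the
    perpendicular bounces, of angle 0.  Along a run the angle is multiplied by
    at most l at each bounce, so trapped orbits converge to them; conversely
    an orbit whose angle tends to 0 passes between adjacent sides only
    finitely often, hence is trapped ([basin_T]).  Hyperbolicity: a point of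
    an invariant set outside T is reached, from some passage between adjacent
    sides, by a bounded number of bounces, so the angle is bounded away from 0
    on the set ([invariant_angle_ge]).  Measuring ds by cos theta |ds|, the
    horizontal direction is then expanded by the factor
    cos f(thetabar) / cos thetabar >= nu > 1, while dtheta is contracted;
    a graph transform yields the stable line field
    ([skew_product_hyperbolic]). *)

(** * Vectors of the plane *)

Section PlaneVectors.
Context {R : realType}.
Implicit Types (p u w : (R * R)%type).

Definition rot90 u : R * R := (- u.2, u.1).

Lemma dotpDr u p (p' : R * R) : dotp u (p + p') = dotp u p + dotp u p'.
Proof. by rewrite /dotp /=; ring. Qed.

Lemma dotpZr u (r : R) p : dotp u (r *: p) = r * dotp u p.
Proof. by rewrite /dotp /= /GRing.scale /=; ring. Qed.

Lemma dotpNl (u w : R * R) : dotp (- u) w = - dotp u w.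
Proof. by rewrite /dotp /=; ring. Qed.

Lemma dotpN (u w : R * R) : dotp u (- w) = - dotp u w.
Proof. by rewrite /dotp /=; ring. Qed.

Lemma dotp_enorm u : dotp u u = enorm u ^+ 2.
Proof. by rewrite /enorm sqr_sqrtr // addr_ge0 // -expr2 sqr_ge0. Qed.

Lemma enormN u : enorm (- u) = enorm u.
Proof. by rewrite /enorm /dotp /= !mulrNN. Qed.

(** By Lagrange's identity the cross product of orthogonal vectors is the product
    of their norms, up to a sign that the orientation decides; the two scalar
    equations then determine the second vector. *)
Lemma rot90_unique (p u : R * R) : 0 < enorm p -> 0 < enorm u ->
  dotp p u = 0 -> 0 < crossp p u ->
  (enorm u)^-1 *: u = rot90 ((enorm p)^-1 *: p).
Proof.
move=> p0 u0; have := dotp_enorm p; have := dotp_enorm u.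
move: (enorm p) (enorm u) p0 u0 => a b a0 b0.
case: p u => p q [r s]; rewrite /dotp /crossp /rot90 /GRing.scale /= => hb ha o c.
have c2 : (p * s - q * r) ^+ 2 = (a * b) ^+ 2.
  rewrite exprMn -ha -hb [RHS](_ : _ = (p * s - q * r) ^+ 2 + (p * r + q * s) ^+ 2).
    by rewrite o expr0n addr0.
  by ring.
have cE : p * s - q * r = a * b.
  by apply/eqP; rewrite -(eqrXn2 (n := 2)) ?c2 ?mulr_ge0 ?ltW.
have aN : a != 0 by rewrite gt_eqF.
have bN : b != 0 by rewrite gt_eqF.
have rE : a * r = - b * q.
  apply: (mulfI aN); rewrite mulrA -expr2 -ha [RHS](_ : _ = - q * (a * b)); last by ring.
  by rewrite -cE -[RHS]addr0 -(mulr0 p) -o; ring.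
have sE : a * s = b * p.
  apply: (mulfI aN); rewrite mulrA -expr2 -ha [RHS](_ : _ = p * (a * b)); last by ring.
  by rewrite -cE -[RHS]addr0 -(mulr0 q) -o; ring.
congr pair; apply: (mulfI aN); apply: (mulfI bN); rewrite /GRing.scale /=.
  by transitivity (a * r); [|rewrite rE]; field; rewrite ?aN ?bN.
by transitivity (a * s); [|rewrite sE]; field; rewrite ?aN ?bN.
Qed.

Lemma ler_norm1_enorm w : `|w.1| <= enorm w.
Proof.
rewrite -sqrtr_sqr /enorm; apply: ler_wsqrtr.
by rewrite /dotp -!expr2 lerDl sqr_ge0.
Qed.

Lemma ler_norm2_enorm w : `|w.2| <= enorm w.
Proof.
rewrite -sqrtr_sqr /enorm; apply: ler_wsqrtr.
by rewrite /dotp -!expr2 lerDr sqr_ge0.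
Qed.

Lemma enorm_le w : enorm w <= `|w.1| + `|w.2|.
Proof.
rewrite -[leRHS]ger0_norm ?addr_ge0 // -sqrtr_sqr /enorm; apply: ler_wsqrtr.
rewrite /dotp -!expr2 -(real_normK (num_real w.1)) -(real_normK (num_real w.2)).
by rewrite sqrrD addrAC lerDl mulrn_wge0 // mulr_ge0.
Qed.

End PlaneVectors.

(** * The boundary of a polygon and free flights in its hull *)

Section PolygonBoundary.
Context {R : realType} {n : nat} (C : 'I_n.+1 -> (R * R)%type).
Implicit Types (i j : 'I_n.+1) (s : R) (p u : (R * R)%type).

Lemma corner0 : corner C 0 = 0.
Proof. by rewrite /corner big_pred0. Qed.

Lemma cornerS i : corner C i.+1 = corner C i + enorm (side C i).
Proof.
rewrite /corner (bigD1 i) //= addrC; congr (_ + _).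
by apply: eq_bigl => j; rewrite ltnS andbC -ltn_neqAle.
Qed.

Lemma corner_le (a b : nat) : (a <= b)%N -> corner C a <= corner C b.
Proof.
move=> ab; rewrite /corner big_mkcond [leRHS]big_mkcond /=.
apply: ler_sum => j _; case: ifP => [ja|_]; first by rewrite (leq_trans ja ab).
by case: ifP => _ //; exact: sqrtr_ge0.
Qed.

Lemma sum_side (m : nat) : (m <= n)%N ->
  C ord0 + \sum_(k < n.+1 | (k < m)%N) side C k = C (inord m).
Proof.
elim: m => [|m IH] mn.
  by rewrite big_pred0 // addr0; congr (C _); apply/val_inj; rewrite /= inordK.
have mK : (inord m : 'I_n.+1) = m :> nat by rewrite inordK // ltnS ltnW.
rewrite (bigD1 (inord m)) /= ?mK // addrCA (eq_bigl (fun k : 'I__ => (k < m)%N)).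
  rewrite IH 1?ltnW // /side subrK; congr (C _); apply/val_inj => /=.
  by rewrite mK modn_small ?inordK ?ltnS.
by move=> k; rewrite ltnS -val_eqE /= mK andbC -ltn_neqAle.
Qed.

(** At arclength s on side i, the coefficients of the earlier sides are saturated
    at 1 and those of the later sides vanish; the earlier sides telescope to the
    vertex [C i]. *)
Lemma zetaE i s : (forall j, 0 < enorm (side C j)) ->
  corner C i <= s <= corner C i.+1 ->
  zeta C s = C i + ((s - corner C i) / enorm (side C i)) *: side C i.
Proof.
move=> Lpos /andP[is_ si].
rewrite /zeta (bigD1 i) //= (bigID (fun k : 'I__ => (k < i)%N)) /=.
rewrite [X in _ + (_ + (_ + X))]big1 ?addr0; last first.
  move=> k /andP[ki]; rewrite -leqNgt leq_eqVlt val_eqE eq_sym (negPf ki) /= => ik.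
  have := le_trans si (corner_le ik); rewrite -subr_le0 => h.
  by rewrite (max_idPr h) (min_idPl (ltW (Lpos k))) mul0r scale0r.
rewrite (eq_bigr (side C)) => [|k /andP[ki klti]]; last first.
  have := le_trans (corner_le klti) is_; rewrite cornerS -lerBrDl => h.
  have /max_idPl -> : 0 <= s - corner C k by apply: le_trans h; exact: ltW.
  by rewrite (min_idPr h) divff ?scale1r // gt_eqF.
rewrite (eq_bigl (fun k : 'I__ => (k < i)%N)); last first.
  by move=> k; rewrite -val_eqE; case: ltngtP.
rewrite [X in _ + X]addrC addrA sum_side ?inord_val -1?ltnS //.
move: si; rewrite cornerS -lerBlDl => si.
by rewrite (max_idPl _) ?subr_ge0// (min_idPl si).
Qed.

Lemma derive1_zeta i s : (forall j, 0 < enorm (side C j)) ->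
  corner C i < s < corner C i.+1 ->
  derive1 (zeta C) s = (enorm (side C i))^-1 *: side C i.
Proof.
move=> Lpos /andP[is_ si].
have E : \forall r \near s, zeta C r =
    (C i - (corner C i / enorm (side C i)) *: side C i)
      + r *: ((enorm (side C i))^-1 *: side C i).
  near=> r; rewrite (@zetaE i) //; first last.
    apply/andP; split; near: r; first exact: lt_le_nbhsr.
    by have := lt_nbhsl si; apply: filterS => y /ltW.
  by rewrite scalerA mulrBl scalerBl addrAC addrA.
rewrite derive1E (near_eq_derive _ E).
have D : is_derive s 1 (fun r : R => r *: ((enorm (side C i))^-1 *: side C i))
   ((enorm (side C i))^-1 *: side C i).
  have L : is_diff s ( *:%R^~ ((enorm (side C i))^-1 *: side C i))
    ( *:%R^~ ((enorm (side C i))^-1 *: side C i)).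
    exact: is_diff_scalel.
  split; first by apply: diff_derivable.
  by rewrite deriveE // diff_val scale1r.
by rewrite deriveD // derive_cst derive_val add0r.
Unshelve. all: by end_near. Qed.

Lemma hull_vertex i : hull C (C i).
Proof.
exists (fun j => (j == i)%:R); split=> [j||]; first exact: ler0n.
  by rewrite (bigD1 i) //= eqxx big1 ?addr0 // => j /negPf ->.
rewrite (bigD1 i) //= eqxx scale1r big1 ?addr0 // => j /negPf ->.
by rewrite scale0r.
Qed.

Lemma hull_convex p u (r : R) : hull C p -> hull C u -> 0 <= r <= 1 ->
  hull C ((1 - r) *: p + r *: u).
Proof.
move=> [a [a0 a1 ->]] [b [b0 b1 ->]] /andP[r0 r1].
exists (fun i => (1 - r) * a i + r * b i); split.
- by move=> i; rewrite addr_ge0 // mulr_ge0 // subr_ge0.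
- by rewrite big_split -!mulr_sumr a1 b1 /=; ring.
- rewrite !scaler_sumr -big_split; apply: eq_bigr => i _.
  by rewrite !scalerA scalerDl.
Qed.

Lemma hull_halfplane u (c : R) p :
  (forall i, c <= dotp u (C i)) -> hull C p -> c <= dotp u p.
Proof.
move=> hC [a [a0 a1 ->]].
have -> : dotp u (\sum_i a i *: C i) = \sum_i a i * dotp u (C i).
  elim/big_rec2: _ => [|i y1 y2 _ <-]; first by rewrite /dotp /= !mulr0 addr0.
  by rewrite dotpDr dotpZr.
rewrite -[leLHS]mul1r -a1 mulr_suml; apply: ler_sum => i _.
exact: ler_wpM2l.
Qed.

Lemma hull_zeta i s : (forall j, 0 < enorm (side C j)) ->
  corner C i <= s <= corner C i.+1 -> hull C (zeta C s).
Proof.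
move=> Lpos si; rewrite (zetaE Lpos si).
have /andP[h1 h2] := si.
set r := _ / _.
have -> : C i + r *: side C i = (1 - r) *: C i + r *: C (ordS i).
  by rewrite /side scalerBr scalerBl scale1r addrA addrAC.
apply: hull_convex; [exact: hull_vertex|exact: hull_vertex|].
rewrite divr_ge0 ?subr_ge0 ?(ltW (Lpos _)) //=.
by rewrite ler_pdivrMr // mul1r lerBlDl -cornerS.
Qed.

(** Identifies the supremum that defines the time of flight, without computing
    it: convexity keeps the open segment inside up to the landing point, and a
    supporting half-plane through that point, which the ray leaves transversally,
    excludes any longer flight. *)
Lemma free_flight (x : R * R) (tau : R) u :
  hull C (q C x) -> hull C (q C x + tau *: v C x) -> 0 < tau ->
  (forall i, dotp u (q C x + tau *: v C x) <= dotp u (C i)) ->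
  dotp u (v C x) < 0 ->
  t C (hull C) x = tau.
Proof.
move=> h0 h1 tau0 hu uv; rewrite /t.
move: (q C x) (v C x) h0 h1 hu uv => Q w h0 h1 hu uv; set A := [set _ | _].
have ubA : ubound A tau.
  move=> r [r0 hr]; rewrite leNgt; apply/negP => taur.
  (* a point of the segment strictly beyond the landing point *)
  pose z := (tau / r + 1) / 2.
  have tr : tau / r < 1 by rewrite ltr_pdivrMr // mul1r.
  have tr0 : 0 < tau / r by rewrite divr_gt0.
  have : open_segment Q (Q + r *: w) (Q + (z * r) *: w).
    exists z; first by rewrite /= /z; apply/andP; split; lra.
    by rewrite [Q + r *: _ - _]addrAC subrr add0r scalerA.
  move=> /hr /(hull_halfplane hu); apply/negP; rewrite -ltNge !dotpDr ltrD2l !dotpZr.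
  have -> : z * r = (tau + r) / 2 by rewrite /z; field; rewrite gt_eqF.
  rewrite ltr_nM2r //; lra.
have Atau : A tau.
  split => // y [r /andP[r0 r1] <-].
  have -> : Q + r *: (Q + tau *: w - Q)
    = (1 - r) *: Q + r *: (Q + tau *: w).
    rewrite [Q + tau *: _ - _]addrAC subrr add0r scalerBl scale1r scalerDr.
    by rewrite addrA subrK.
  by apply: hull_convex => //; rewrite !ltW.
apply/eqP; rewrite eq_le ge_sup //=; last by exists tau.
by apply: ub_le_sup => //; exists tau.
Qed.

End PolygonBoundary.

(** * Frames adapted to a rectangle *)

Section RectangleFrame.
Context {R : realType}.
Implicit Types (C : 'I_4 -> (R * R)%type) (i j k : 'I_4) (s : R).
Implicit Types (x p u : (R * R)%type).

Lemma ord4P i k :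
  [\/ k = i, k = ordS i, k = ordS (ordS i) | k = ordS (ordS (ordS i))].
Proof.
case: i => [[|[|[|[|//]]]] hi]; case: k => [[|[|[|[|//]]]] hk];
  by [constructor 1; exact: val_inj | constructor 2; exact: val_inj
     | constructor 3; exact: val_inj | constructor 4; exact: val_inj].
Qed.

Lemma ordS4 i : ordS (ordS (ordS (ordS i))) = i.
Proof. by case: i => [[|[|[|[|//]]]] hi]; exact: val_inj. Qed.

Definition len C i : R := enorm (side C i).
Definition dir C i : R * R := (len C i)^-1 *: side C i.

(** All that is used of a rectangle.  Indices are cyclic through [ordS], so every
    argument can be made for one side and then holds for all four. *)
Record rect_frame C : Prop := RectFrame {
  len_gt0 : forall i, 0 < len C i;
  dir_turn : forall i, dir C (ordS i) = rot90 (dir C i);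
  len_opp : forall i, len C (ordS (ordS i)) = len C i }.

(** The alternative on the side lengths keeps the two orders of the lengths 1 and h
    in one statement. *)
Lemma rectangle_frame C (a b : R) : 0 < a -> 0 < b -> is_rectangle C a b ->
  rect_frame C /\
  forall i, (len C i = a /\ len C (ordS i) = b) \/
            (len C i = b /\ len C (ordS i) = a).
Proof.
move=> a0 b0 [] /=.
have E k : (k < 4)%N -> ordS (inord k : 'I_4) = inord (k.+1 %% 4).
  by move=> k4; apply: val_inj; rewrite /= !inordK // ltn_mod.
have E0 := E 0 isT; have E1 := E 1 isT; have E2 := E 2 isT; have E3 := E 3 isT.
rewrite -[(1 %% 4)%N]/1%N in E0; rewrite -[(2 %% 4)%N]/2%N in E1.
rewrite -[(3 %% 4)%N]/3%N in E2; rewrite -[(4 %% 4)%N]/0%N in E3.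
set i0 := inord 0 in E0 E3 *; set i1 := inord 1 in E0 E1 *.
set i2 := inord 2 in E1 E2 *; set i3 := inord 3 in E2 E3 *.
move=> par orth ccw la lb.
have S0 : side C i0 = C i1 - C i0 by rewrite /side E0.
have S1 : side C i1 = C i2 - C i1 by rewrite /side E1.
have S2 : side C i2 = - side C i0 by rewrite S0 par opprB /side E2.
have S3 : side C i3 = - side C i1.
  rewrite S1 /side E3 opprB; apply/eqP; rewrite subr_eq addrAC eq_sym subr_eq.
  by rewrite -(subrK (C i0) (C i1)) par addrAC subrK addrC.
rewrite -S0 -S1 in orth ccw la lb.
have L0 : len C i0 = a by [].
have L1 : len C i1 = b by [].
have L2 : len C i2 = a by rewrite /len S2 enormN.
have L3 : len C i3 = b by rewrite /len S3 enormN.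
have T0 : dir C i1 = rot90 (dir C i0).
  by apply: rot90_unique; rewrite ?la ?lb.
have T1 : dir C i2 = rot90 (dir C i1).
  by rewrite T0 /dir S2 L2 L0 scalerN; case: (_ *: _).
have T2 : dir C i3 = rot90 (dir C i2).
  rewrite [LHS]/dir S3 L3 scalerN -L1 -/(dir C i1) T1 T0.
  by case: (dir C i0).
have T3 : dir C i0 = rot90 (dir C i3).
  by rewrite T2 T1 T0; case: (dir C i0) => p q; rewrite /rot90 /= !opprK.
have W i : [\/ i = i0, i = i1, i = i2 | i = i3].
  by have := ord4P i0 i; rewrite E0 E1 E2.
split; first split => i.
- by case: (W i) => ->; rewrite ?L0 ?L1 ?L2 ?L3.
- by case: (W i) => ->; rewrite ?E0 ?E1 ?E2 ?E3.
- by case: (W i) => ->; rewrite ?E0 ?E1 ?E2 ?E3 ?E0 ?E1 ?L0 ?L1 ?L2 ?L3.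
move=> i.
by case: (W i) => ->; rewrite ?E0 ?E1 ?E2 ?E3 ?L0 ?L1 ?L2 ?L3; [left|right|left|right].
Qed.

End RectangleFrame.

(** * Where the particle lands *)

Section RectangleBilliard.
Context {R : realType} (C : 'I_4 -> (R * R)%type).
Hypothesis FR : rect_frame C.
Implicit Types (i j k : 'I_4) (s : R) (x : (R * R)%type).

Definition inside i s : Prop := corner C i < s < corner C i.+1.

Lemma inside_closed i s : inside i s -> corner C i <= s <= corner C i.+1.
Proof. by move=> /andP[? ?]; rewrite !ltW. Qed.

Lemma cornerSl i : corner C i.+1 = corner C i + len C i.
Proof. exact: cornerS. Qed.

Lemma vertexS i : C (ordS i) = C i + len C i *: dir C i.
Proof.
by rewrite /dir scalerA divff ?gt_eqF ?(len_gt0 FR)// scale1r /side addrC subrK.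
Qed.

Lemma dir_unit i : dotp (dir C i) (dir C i) = 1.
Proof.
have l0 := len_gt0 FR i.
rewrite [LHS](_ : _ = (len C i)^-1 ^+ 2 * dotp (side C i) (side C i)); last first.
  by rewrite /dotp /dir /GRing.scale /= /GRing.scale /=; ring.
by rewrite dotp_enorm -/(len C i) exprVn mulVf // expf_neq0 // gt_eqF.
Qed.

Lemma zeta_dir i s : corner C i <= s <= corner C i.+1 ->
  zeta C s = C i + (s - corner C i) *: dir C i.
Proof. by move=> h; rewrite (zetaE (len_gt0 FR) h) /dir scalerA. Qed.

Lemma derive1_zeta_dir i s : inside i s -> derive1 (zeta C) s = dir C i.
Proof. by move=> h; rewrite (derive1_zeta (len_gt0 FR) h). Qed.

Lemma v_dir i x : inside i x.1 ->
  v C x = sin x.2 *: dir C i + cos x.2 *: rot90 (dir C i).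
Proof.
move=> h; rewrite /v (derive1_zeta_dir h) /Defs.rot.
have -> : cos (pi / 2 - x.2) = sin x.2.
  by rewrite -opprB cosN cosBpihalf.
have -> : sin (pi / 2 - x.2) = cos x.2.
  by rewrite -opprB sinN sinBpihalf opprK.
by rewrite [RHS]surjective_pairing; congr pair;
  rewrite /= /GRing.scale /= /GRing.scale /=; ring.
Qed.

(** Locates an arbitrary parameter on some closed side; applied to the competitors
    of the landing parameter in the choice made by [s1]. *)
Lemma corner_cover s : 0 <= s <= perimeter C ->
  exists i : 'I_4, corner C i <= s <= corner C i.+1.
Proof.
move=> /andP[s0]; rewrite /perimeter; have : (4 <= 4)%N by [].
elim: {1 3}4%N => [_|m IH m4 sm].
  rewrite corner0 => h; exists ord0 => /=; rewrite corner0 s0 /=.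
  by rewrite (le_trans h) // -(corner0 C) corner_le.
have [sm'|sm'] := leP s (corner C m); first by apply: IH sm'; exact: ltnW.
by exists (Ordinal m4); rewrite /= sm (ltW sm').
Qed.

Lemma inside_unique i j s :
  inside i s -> corner C j <= s <= corner C j.+1 -> j = i.
Proof.
move=> /andP[a b] /andP[c d]; apply/val_inj => /=; case: (ltngtP j i) => // ij.
  have := corner_le C ij; have := le_lt_trans (corner_le C ij) a => h _.
  by have := lt_le_trans h d; rewrite ltxx.
have := corner_le C ij => h.
by have := lt_le_trans b (le_trans h c); rewrite ltxx.
Qed.

Definition inward i := rot90 (dir C i).

Lemma dot_dir i : dotp (inward i) (dir C i) = 0.
Proof. by rewrite /inward /rot90 /dotp /=; ring. Qed.

Lemma dot_inward i : dotp (inward i) (inward i) = 1.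
Proof. by rewrite -(dir_unit i) /inward /rot90 /dotp /=; ring. Qed.

Lemma dot_dir_inward i : dotp (dir C i) (inward i) = 0.
Proof. by rewrite /inward /rot90 /dotp /=; ring. Qed.

Lemma inwardS i : inward (ordS i) = - dir C i.
Proof. by rewrite /inward (dir_turn FR); case: (dir C i). Qed.

Lemma dir_opp i : dir C (ordS (ordS i)) = - dir C i.
Proof. by rewrite (dir_turn FR) -/(inward _) inwardS. Qed.

(** The rectangle lies on the inner side of each of its edges; this provides the
    supporting half-plane required by [free_flight]. *)
Lemma side_halfplane j k : dotp (inward j) (C j) <= dotp (inward j) (C k).
Proof.
have Ej : dotp (inward j) (C (ordS j)) = dotp (inward j) (C j).
  by rewrite vertexS dotpDr dotpZr dot_dir mulr0 addr0.
have L1 := ltW (len_gt0 FR (ordS j)).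
have Ej2 : dotp (inward j) (C (ordS (ordS j))) =
    dotp (inward j) (C j) + len C (ordS j).
  by rewrite vertexS dotpDr dotpZr (dir_turn FR) dot_inward mulr1 Ej.
case: (ord4P j k) => ->; rewrite ?Ej2 ?Ej ?lerDl //.
rewrite vertexS dotpDr dotpZr Ej2 dir_opp -scaleN1r dotpZr dot_dir !mulr0 addr0.
by rewrite lerDl.
Qed.

(** A ray that meets a side from inside lands there.  The parameter [s] may be an
    endpoint of the side, so that rays into a vertex are covered too. *)
Lemma hit i j x s (tau : R) : inside i x.1 ->
  corner C j <= s <= corner C j.+1 -> 0 < tau ->
  zeta C s = q C x + tau *: v C x -> dotp (inward j) (v C x) < 0 ->
  q1 C (hull C) x = zeta C s.
Proof.
move=> xi sj tau0 E vn; rewrite /q1 (@free_flight _ _ C x tau (inward j)) //.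
- exact: hull_zeta (len_gt0 FR) (inside_closed xi).
- by rewrite -E; exact: hull_zeta (len_gt0 FR) sj.
- move=> k; rewrite -E (zeta_dir sj) dotpDr dotpZr dot_dir mulr0 addr0.
  exact: side_halfplane.
Qed.

(** The three smooth branches of the map on a given side.  Rightward is the passage
    to the next side in counterclockwise order. *)
Inductive branch := Across | Rightward | Leftward.

Definition target b i :=
  match b with
  | Across => ordS (ordS i)
  | Rightward => ordS i
  | Leftward => ordS (ordS (ordS i))
  end.

(** The incoming angle on the target side is [turn b - theta]. *)
Definition turn b : R :=
  match b with Across => 0 | Rightward => pi / 2 | Leftward => - (pi / 2) end.

(** The landing parameter is affine in the arclength s with this coefficient; its
    constant term is split off in [offset]. *)
Definition slope b (th : R) : R :=
  match b with
  | Across => -1 | Rightward => - (tan th)^-1 | Leftward => (tan th)^-1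
  end.

Definition offset b i (th : R) : R :=
  match b with
  | Across => len C i - len C (ordS i) * tan th
  | Rightward => len C i / tan th
  | Leftward => len C (ordS i)
  end.

Definition landing b i x : R :=
  corner C (target b i) + ((x.1 - corner C i) * slope b x.2 + offset b i x.2).

(** The abscissa, along side i, at which the ray crosses the line of the opposite
    side.  Comparing it with 0 and the length of the side selects the branch. *)
Definition reach i x : R := x.1 - corner C i + len C (ordS i) * tan x.2.

Lemma landing_across i x :
  landing Across i x = corner C (ordS (ordS i)) + (len C i - reach i x).
Proof. by rewrite /landing /= /reach; ring. Qed.

(** The domain of a branch.  All inequalities are strict: rays into a vertex are
    excluded, and the condition is open. *)
Definition aims b i x : Prop :=
  [/\ inside i x.1, Iangle x.2 &
    match b with
    | Across => 0 < reach i x < len C i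
    | Rightward => len C i < reach i x
    | Leftward => reach i x < 0
    end].

Lemma Iangle_itv (a : R) : Iangle a -> a \in `]- (pi / 2), pi / 2[.
Proof. by rewrite in_itv. Qed.

Lemma Iangle0 : Iangle (0 : R).
Proof. by rewrite /Iangle /= oppr_lt0 divr_gt0 ?pi_gt0. Qed.

Lemma IangleN (a : R) : Iangle a -> Iangle (- a).
Proof. by rewrite /Iangle /= ltrN2 ltrNl => /andP[-> ->]. Qed.

Lemma tan_gt0E (a : R) : Iangle a -> (0 < tan a) = (0 < a).
Proof. by move=> ha; rewrite -{1}tan0 ltr_tan ?Iangle_itv //; exact: Iangle0. Qed.

Lemma tan_lt0E (a : R) : Iangle a -> (tan a < 0) = (a < 0).
Proof. by move=> ha; rewrite -{1}tan0 ltr_tan ?Iangle_itv //; exact: Iangle0. Qed.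

(** Overshooting the right end of the side forces the ray to lean to the right. *)
Lemma aims_gt0 i x : aims Rightward i x -> 0 < x.2.
Proof.
move=> [/andP[_ h] hx]; rewrite /reach -(tan_gt0E hx) => r.
move: h; rewrite cornerSl => h.
by rewrite -(pmulr_rgt0 _ (len_gt0 FR (ordS i))); lra.
Qed.

Lemma aims_lt0 i x : aims Leftward i x -> x.2 < 0.
Proof.
move=> [/andP[h _] hx]; rewrite /reach -(tan_lt0E hx) => r.
by rewrite -(pmulr_rlt0 _ (len_gt0 FR (ordS i))); lra.
Qed.

Lemma tanE (a : R) : cos a != 0 -> sin a = tan a * cos a.
Proof. by move=> h; rewrite /tan mulfVK. Qed.

Lemma dir_v i x : inside i x.1 -> dotp (dir C i) (v C x) = sin x.2.
Proof.
move=> xi; rewrite (v_dir xi) dotpDr (dotpZr _ (sin _)) (dotpZr _ (cos _)).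
by rewrite dir_unit dot_dir_inward mulr1 mulr0 addr0.
Qed.

Lemma inward_v i x : inside i x.1 -> dotp (inward i) (v C x) = cos x.2.
Proof.
move=> xi; rewrite (v_dir xi) dotpDr (dotpZr _ (sin _)) (dotpZr _ (cos _)).
by rewrite dot_inward dot_dir mulr1 mulr0 add0r.
Qed.

(** The bounds on [reach] are weak here: in the boundary cases the ray hits a
    vertex, which is how the singular set is detected in [dom_aims]. *)
Lemma hit_across i x : inside i x.1 -> Iangle x.2 -> 0 <= reach i x <= len C i ->
  q1 C (hull C) x = zeta C (landing Across i x).
Proof.
move=> xi hx /andP[r0 r1].
have c0 : 0 < cos x.2 by apply: cos_gt0_pihalf.
have cN : cos x.2 != 0 by rewrite gt_eqF.
have lE := landing_across i x.
have l2 := len_gt0 FR (ordS i).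
have cl : corner C (ordS (ordS i)) <= landing Across i x
    <= corner C (ordS (ordS i)).+1.
  rewrite lE cornerSl (len_opp FR) lerDl lerD2l subr_ge0 r1 /=.
  by rewrite gerBl.
apply: (@hit i (ordS (ordS i)) _ _ (len C (ordS i) / cos x.2)) => //.
- by rewrite divr_gt0.
- rewrite (zeta_dir cl) lE dir_opp !vertexS (dir_turn FR) (v_dir xi) /q.
  rewrite (zeta_dir (inside_closed xi)) (tanE cN) /reach.
  case: (dir C i) => p p'; case: (C i) => a a'.
  rewrite [LHS]surjective_pairing [RHS]surjective_pairing; congr pair;
    by rewrite /= /GRing.scale /= /GRing.scale /=; field.
- have -> : inward (ordS (ordS i)) = - inward i by rewrite inwardS (dir_turn FR).
  by rewrite dotpNl inward_v // oppr_lt0.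
Qed.

(** The sine of the incoming angle is the tangential component of the velocity on
    the target side.  That the angle lies in the open interval makes [asin]
    recover it. *)
Lemma turn_opposite b i x : aims b i x ->
  Iangle (turn b - x.2) /\
  sin (turn b - x.2) = dotp (dir C (target b i)) (v C x).
Proof.
move=> h; have [xi hx _] := h; have := hx; rewrite /Iangle /= => /andP[hl hr].
case: b h => /= h.
- rewrite sub0r sinN dir_opp dotpNl dir_v //; split=> //.
  by apply/andP; split; lra.
- rewrite -[pi / 2 - _]opprB sinN sinBpihalf opprK (dir_turn FR).
  rewrite inward_v //; split=> //.
  by have := aims_gt0 h; have := pihalf_ge1 R => p1 th0; apply/andP; split; lra.
- rewrite -opprD sinN addrC sinDpihalf (dir_turn FR) dir_opp.
  rewrite -[rot90 (- _)]/(- inward i) dotpNl inward_v //; split=> //.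
  by have := aims_lt0 h; have := pihalf_ge1 R => p1 th0; apply/andP; split; lra.
Qed.

Lemma hit_aims b i x : aims b i x ->
  inside (target b i) (landing b i x) /\
  q1 C (hull C) x = zeta C (landing b i x).
Proof.
move=> h; have [xi hx r] := h; have /andP[xl0 xr0] := xi.
have c0 : 0 < cos x.2 by apply: cos_gt0_pihalf.
have cN : cos x.2 != 0 by rewrite gt_eqF.
have l2 := len_gt0 FR (ordS i); have l1 := len_gt0 FR i.
have xl : 0 < x.1 - corner C i by rewrite subr_gt0.
have xr : x.1 - corner C i < len C i by rewrite ltrBlDl -cornerSl.
case: b h r => /= h r.
- split; last by apply: hit_across => //; case/andP: r => *; rewrite !ltW.
  rewrite /inside cornerSl (len_opp FR) /landing /= ltrDl ltrD2l.
  by move: r; rewrite /reach => /andP[r1 r2]; apply/andP; split; lra.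
- have t0 : 0 < tan x.2 by rewrite tan_gt0E // (aims_gt0 h).
  have s0 : 0 < sin x.2 by rewrite tanE // mulr_gt0.
  have lE : landing Rightward i x = corner C (ordS i)
      + (len C i - (x.1 - corner C i)) / tan x.2 by rewrite /landing /=; ring.
  have yi : inside (ordS i) (landing Rightward i x).
    rewrite /inside lE cornerSl ltrDl ltrD2l divr_gt0 ?subr_gt0 //=.
    by rewrite ltr_pdivrMr // ltrBlDl.
  split => //.
  apply: (@hit i _ _ _ ((len C i - (x.1 - corner C i)) / sin x.2) xi
            (inside_closed yi)).
  + by rewrite divr_gt0 // subr_gt0.
  + rewrite (zeta_dir (inside_closed yi)) lE !vertexS (dir_turn FR) (v_dir xi) /q.
    rewrite (zeta_dir (inside_closed xi)) /tan.
    case: (dir C i) => p p'; case: (C i) => a a'.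
    rewrite [LHS]surjective_pairing [RHS]surjective_pairing; congr pair;
    by rewrite /= /GRing.scale /= /GRing.scale /=; field; rewrite cN gt_eqF.
  + by rewrite inwardS dotpNl dir_v // oppr_lt0.
- have t0 : tan x.2 < 0 by rewrite tan_lt0E // (aims_lt0 h).
  have s0 : sin x.2 < 0 by rewrite tanE // pmulr_llt0.
  have lE : landing Leftward i x = corner C (ordS (ordS (ordS i)))
      + (len C (ordS i) + (x.1 - corner C i) / tan x.2) by rewrite /landing /=; ring.
  have yi : inside (ordS (ordS (ordS i))) (landing Leftward i x).
    rewrite /inside lE cornerSl (len_opp FR) ltrDl ltrD2l gtrDl.
    rewrite -ltrBlDl sub0r ltr_ndivlMr // pmulr_rlt0 // invr_lt0 t0 andbT.
    by move: r; rewrite /reach; lra.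
  split => //.
  apply: (@hit i _ _ _ ((x.1 - corner C i) / - sin x.2) xi (inside_closed yi)).
  + by rewrite divr_gt0 // oppr_gt0.
  + rewrite (zeta_dir (inside_closed yi)) lE dir_turn // dir_opp !vertexS.
    rewrite dir_opp (dir_turn FR) (len_opp FR) (v_dir xi) /q.
    rewrite (zeta_dir (inside_closed xi)) /tan.
    case: (dir C i) => p p'; case: (C i) => a a'.
    rewrite [LHS]surjective_pairing [RHS]surjective_pairing; congr pair;
    by rewrite /= /GRing.scale /= /GRing.scale /=; field; rewrite cN lt_eqF.
  + by rewrite inwardS dir_opp opprK dir_v.
Qed.

End RectangleBilliard.

(** * The billiard map in explicit form *)

Section BilliardStep.
Context {R : realType} (C : 'I_4 -> (R * R)%type) (f : R -> R).
Hypothesis FR : rect_frame C.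
Implicit Types (i j k : 'I_4) (s : R) (x : (R * R)%type) (b : branch).

Lemma dotpZ_dir (u : R * R) (r : R) i :
  dotp u (r *: dir C i) = r * dotp u (dir C i).
Proof. exact: dotpZr. Qed.

(** Needed because [s1] is an arbitrary choice among the parameters that [zeta]
    maps to the landing point.  A point in the interior of side j has coordinates
    (u, 0) with 0 < u < len in the frame of that side, whereas on the other three
    sides either the first coordinate is 0 or len, or the second is positive. *)
Lemma zeta_inj j s s' : inside C j s -> 0 <= s' <= perimeter C ->
  zeta C s' = zeta C s -> s' = s.
Proof.
move=> js /corner_cover[k ks].
have /andP[] := js; rewrite cornerSl => s1 s2.
rewrite (zeta_dir FR ks) (zeta_dir FR (inside_closed js)) => E.
have E1 := congr1 (dotp (dir C j)) E; have E2 := congr1 (dotp (inward C j)) E.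
move: E1 E2; rewrite !dotpDr !dotpZ_dir dir_unit // dot_dir.
have l2 := len_gt0 FR (ordS j).
case: (ord4P j k) ks => -> ks.
- by rewrite dir_unit // => + _; lra.
- rewrite vertexS // dotpDr dotpZ_dir (dir_turn FR) -/(inward C j).
  by rewrite dot_dir_inward dir_unit // => + _; lra.
- rewrite !(vertexS FR) !dotpDr !dotpZ_dir (dir_opp FR) (dir_turn FR) dotpN.
  by rewrite -/(inward C j) dot_inward // dotpN dot_dir => _; lra.
- rewrite !(vertexS FR) !dotpDr !dotpZ_dir (dir_opp FR (ordS j)) (dir_opp FR).
  rewrite (dir_turn FR) -/(inward C j) !dotpN dot_dir_inward dir_unit //.
  by rewrite (len_opp FR) => + _; lra.
Qed.

Lemma corner_bounds (m : nat) : (m <= 4)%N -> 0 <= corner C m <= perimeter C.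
Proof. by move=> m4; rewrite -{1}(corner0 C) !corner_le. Qed.

Lemma inside_perimeter i s : inside C i s -> 0 < s < perimeter C.
Proof.
move=> /andP[h1 h2].
have /andP[a _] := corner_bounds (ltnW (ltn_ord i)).
have /andP[_ b] := corner_bounds (ltn_ord i).
by rewrite (le_lt_trans a h1) (lt_le_trans h2 b).
Qed.

Lemma inside_not_corner i s (m : nat) : inside C i s -> s != corner C m.
Proof.
move=> /andP[h1 h2]; have [mi|im] := leqP m i.
  by rewrite gt_eqF // (le_lt_trans (corner_le C mi)).
by rewrite lt_eqF // (lt_le_trans h2) // corner_le.
Qed.

Lemma zeta_corner i : zeta C (corner C i) = C i.
Proof. by rewrite (zeta_dir FR (i := i)) ?lexx ?corner_le // subrr scale0r addr0. Qed.

Lemma zeta_not_vertex i s k : inside C i s -> zeta C s <> C k.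
Proof.
move=> si E; have /eqP := inside_not_corner k si; apply; apply/esym.
apply: (zeta_inj si); first exact: corner_bounds (ltnW (ltn_ord k)).
by rewrite zeta_corner.
Qed.

Lemma s1_aims b i x : aims C b i x -> s1 C (hull C) x = landing C b i x.
Proof.
move=> h; have [yi E] := hit_aims FR h.
rewrite /s1; apply: xget_unique.
  by split; [exact: inside_perimeter yi | rewrite E].
move=> s [/andP[s0 s1]]; rewrite E; apply: (zeta_inj yi).
by rewrite !ltW.
Qed.

Lemma thetabar_aims b i x : aims C b i x ->
  thetabar1 C (hull C) x = turn b - x.2.
Proof.
move=> h; have [yi E] := hit_aims FR h; have [ht hs] := turn_opposite FR h.
rewrite /thetabar1 /vbar1 (s1_aims h) (derive1_zeta_dir FR yi) dotpDr dotpZr.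
rewrite -scaleN1r dotpZr dir_unit // -hs.
rewrite [X in asin X](_ : _ = sin (turn b - x.2)); last by ring.
by apply: sinK; rewrite in_itv /=; move/andP: ht => [? ?]; rewrite !ltW.
Qed.

Lemma Phi_aims b i x : aims C b i x ->
  Phi C (hull C) f x = (landing C b i x, f (turn b - x.2)).
Proof. by move=> h; rewrite /Phi (s1_aims h) (thetabar_aims h). Qed.

Lemma cvg_reach i x : Iangle x.2 -> reach C i y @[y --> x] --> reach C i x.
Proof.
move=> hx; have c0 : cos x.2 != 0 by rewrite gt_eqF // cos_gt0_pihalf.
apply: cvgD; first by apply: cvgB; [exact: cvg_fst|exact: cvg_cst].
apply: cvgM; first exact: cvg_cst.
apply: (@cvg_comp _ _ _ (fun y : R * R => y.2) tan); first exact: cvg_snd.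
exact: continuous_tan.
Qed.

(** Hence [Phi] is given by a single formula near every point of its domain. *)
Lemma near_aims b i x : aims C b i x -> \forall y \near x, aims C b i y.
Proof.
move=> [/andP[xl xr] /andP[hl hr] r].
have cr := @cvg_reach i x; have {}cr := cr (introT andP (conj hl hr)).
have c1 : (fun y : R * R => y.1) y @[y --> x] --> x.1 by exact: cvg_fst.
have c2 : (fun y : R * R => y.2) y @[y --> x] --> x.2 by exact: cvg_snd.
have I : \forall y \near x, inside C i y.1 /\ Iangle y.2.
  near=> y; split; apply/andP; split; near: y.
  - exact: (cvgr_gt x.1).
  - exact: (cvgr_lt x.1).
  - exact: (cvgr_gt x.2).
  - exact: (cvgr_lt x.2).
case: b r => r.
- near=> y; have [? ?] : inside C i y.1 /\ Iangle y.2 by near: y.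
  split => //; apply/andP; split; near: y; case/andP: r => r1 r2.
    exact: (cvgr_gt (reach C i x)).
  exact: (cvgr_lt (reach C i x)).
- near=> y; have [? ?] : inside C i y.1 /\ Iangle y.2 by near: y.
  by split => //; near: y; exact: (cvgr_gt (reach C i x)).
- near=> y; have [? ?] : inside C i y.1 /\ Iangle y.2 by near: y.
  by split => //; near: y; exact: (cvgr_lt (reach C i x)).
Unshelve. all: by end_near. Qed.

Lemma M_open x : M C x -> nbhs x (M C).
Proof.
move=> [/andP[xl xr] /andP[hl hr]].
have c1 : (fun y : R * R => y.1) y @[y --> x] --> x.1 by exact: cvg_fst.
have c2 : (fun y : R * R => y.2) y @[y --> x] --> x.2 by exact: cvg_snd.
near=> y; split; apply/andP; split; near: y.
- exact: (cvgr_gt x.1).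
- exact: (cvgr_lt x.1).
- exact: (cvgr_gt x.2).
- exact: (cvgr_lt x.2).
Unshelve. all: by end_near. Qed.

(** A point in the interior of a side fails to aim at the interior of a side only
    when its ray ends in a vertex, and then it belongs to [S1].  Conversely a branch
    is open and its rays avoid the vertices, so it does not meet the closure of the
    rays into a vertex. *)
Lemma dom_aims x : dom C (hull C) x <-> exists b i, aims C b i x.
Proof.
split.
  move=> [[/andP[x0 x1] hx]] /not_orP[/not_orP[_ nV] nS].
  have [|i /andP[xl xr]] := @corner_cover _ C x.1; first by rewrite !ltW.
  have noC m : (m <= 4)%N -> x.1 != corner C m.
    by move=> m4; apply/eqP => E; apply: nV; split => //; exists m.
  have xi : inside C i x.1.
    rewrite /inside !lt_neqAle xl xr eq_sym !noC //.
    exact: ltnW (ltn_ord i).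
  have hit k : q1 C (hull C) x <> C k.
    move=> E; apply: nS; exists k => //; apply: subset_closure; split => //.
    split; first by split => //; apply/andP; split.
    by move=> [[m m4 Em] _]; move/eqP: (noC m m4); apply.
  (* equality at either end would send the ray into a vertex *)
  have hitl : 0 <= reach C i x <= len C i -> 0 < reach C i x < len C i.
    move=> r; have E := hit_across FR xi hx r.
    have El := landing_across C i x; case/andP: r => r0 r1.
    rewrite !lt_neqAle r0 r1 !andbT; apply/andP; split; apply/eqP => E0.
      apply: (hit (ordS (ordS (ordS i)))); rewrite E El -E0 subr0.
      rewrite (zeta_dir FR (i := ordS (ordS i))) ?cornerSl ?(len_opp FR).
        by rewrite (vertexS FR (ordS (ordS i))) (len_opp FR) addrAC subrr add0r.
      by rewrite lexx andbT lerDl ltW // (len_gt0 FR).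
    by apply: (hit (ordS (ordS i))); rewrite E El E0 subrr addr0 zeta_corner.
  have [r0|r0] := ltP (reach C i x) 0; first by exists Leftward, i.
  have [r1|r1] := ltP (len C i) (reach C i x); first by exists Rightward, i.
  by exists Across, i; split => //; apply: hitl; rewrite r0.
move=> [b [i h]]; have [xi hx _] := h.
have Mx : M C x by split => //; exact: inside_perimeter xi.
split => // -[[[_]|[[m _ E] _]]|[k _ /(_ _ (near_aims h))]].
- by apply; exact: M_open.
- by move/eqP: (inside_not_corner m xi).
- move=> [y [[_ Ey] hy]]; have [yi E] := hit_aims FR hy.
  by apply: (zeta_not_vertex yi); rewrite -E Ey.
Qed.

End BilliardStep.

(** * The differential of the billiard map *)

Section LocalDifferential.
Context {R : realType}.

(** Transfers differentiability and the differential from the explicit branch to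
    [Phi], which agrees with it only near the point. *)
Lemma near_eq_is_diff (V W : normedModType R) (f g : V -> W) (x : V) :
  (\forall y \near x, f y = g y) -> differentiable f x -> is_diff x g ('d f x).
Proof.
move=> fg df; have [cf Ef] := (diff_locallyP x f).1 df.
have Eg : g \o shift x = cst (g x) + 'd f x +o_ (0 : V) id.
  apply/eqaddoP => e e0; have /eqaddoP/(_ _ e0) := Ef.
  have fg0 : \forall z \near (0 : V), f (z + x) = g (z + x).
    have c : z + x @[z --> (0 : V)] --> x.
      by rewrite -[X in _ --> X]add0r; apply: cvgD; [exact: cvg_id|exact: cvg_cst].
    exact: c fg.
  move=> h; near=> z.
  have : `|(f \o shift x - (cst (f x) + 'd f x)) z| <= e * `|id z| by near: z.
  have Ez : f (z + x) = g (z + x) by near: z.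
  have E0 : f x = g x := nbhs_singleton fg.
  by rewrite /= !fctE /= /cst /= Ez E0.
have dg : 'd g x = 'd f x :> (V -> W) by exact: diff_unique.
split; last exact: dg.
by apply/(diff_locallyP x g); rewrite dg; split.
Unshelve. all: by end_near. Qed.

Lemma is_derive_is_diff (g : R -> R) (a d : R) :
  is_derive a 1 g d -> is_diff a g ( *:%R^~ d).
Proof.
move=> h; have dg : differentiable g a by apply/derivable1_diffP.
by split => //; rewrite diff1E // derive1E derive_val.
Qed.

Lemma is_diff_fst (x : R * R) : is_diff x (@fst R R) (@fst R R).
Proof.
have c : continuous (@fst R R) by move=> y; exact: cvg_fst.
by split; [exact: linear_differentiable c|exact: diff_lin c].
Qed.

Lemma is_diff_snd (x : R * R) : is_diff x (@snd R R) (@snd R R).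
Proof.
have c : continuous (@snd R R) by move=> y; exact: cvg_snd.
by split; [exact: linear_differentiable c|exact: diff_lin c].
Qed.

(** The common shape of the three branches: affine in the arclength, with
    coefficients that depend on the angle. *)
Lemma is_diff_billiard_branch (K c kappa : R) (al be : R -> R) (f : R -> R)
    (x : R * R) (al' be' f' : R) :
  is_derive x.2 1 al al' -> is_derive x.2 1 be be' ->
  is_derive (kappa - x.2) 1 f f' ->
  is_diff x (fun y : R * R =>
      (K + ((y.1 - c) * al y.2 + be y.2), f (kappa - y.2)))
    (fun w => (al x.2 * w.1 + ((x.1 - c) * al' + be') * w.2, - f' * w.2)).
Proof.
move=> /is_derive_is_diff dal /is_derive_is_diff dbe /is_derive_is_diff df.
have d1 : is_diff x (fun y : R * R => y.1 - c) fst.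
  apply: is_diff_eq; last exact: subr0.
  exact: is_diffB (is_diff_fst x) (is_diff_cst c x).
have da : is_diff x (al \o snd) ( *:%R^~ al' \o snd).
  exact: is_diff_comp (is_diff_snd x) _.
have db : is_diff x (be \o snd) ( *:%R^~ be' \o snd).
  exact: is_diff_comp (is_diff_snd x) _.
have dk : is_diff x (fun y : R * R => kappa - y.2) (- snd).
  apply: is_diff_eq; last exact: sub0r.
  exact: is_diffB (is_diff_cst kappa x) (is_diff_snd x).
have dF : is_diff x (fun y : R * R => f (kappa - y.2)) ( *:%R^~ f' \o (- snd)).
  exact: (@is_diff_comp _ _ _ _ (fun y : R * R => kappa - y.2) _ f).
have dP := is_diff_pair
  (is_diffD (is_diff_cst K x) (is_diffD (is_diffM d1 da) db)) dF.
apply: (is_diff_eq dP).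
apply/funext => w /=; rewrite !fctE /= /GRing.scale /=; congr pair; last by ring.
rewrite [X in X + _ = _](_ : _ = 0 :> R) //; ring.
Qed.
End LocalDifferential.

Section BilliardDifferential.
Context {R : realType} (C : 'I_4 -> (R * R)%type) (f : R -> R).
Hypothesis FR : rect_frame C.
Implicit Types (i : 'I_4) (x : (R * R)%type) (b : branch).

(** The partial derivative of the landing parameter with respect to the angle: minus
    the time of flight divided by the cosine of the incoming angle. *)
Definition shear b i x : R :=
  match b with
  | Across => - (len C (ordS i) / cos x.2 ^+ 2)
  | Rightward => (x.1 - corner C i - len C i) / sin x.2 ^+ 2
  | Leftward => - ((x.1 - corner C i) / sin x.2 ^+ 2)
  end.

Lemma is_derive_cot (a : R) : cos a != 0 -> sin a != 0 ->
  is_derive a 1 (fun z => (tan z)^-1) (- (sin a) ^-2).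
Proof.
move=> ca sa; have ta : tan a != 0 by rewrite /tan mulf_neq0 ?invr_eq0.
apply: (is_derive_eq (is_deriveV ta (is_derive_tan ca))).
by rewrite /tan /GRing.scale /=; field; rewrite ca sa.
Qed.

Lemma aims_sin_neq0 b i x : aims C b i x -> b <> Across -> sin x.2 != 0.
Proof.
move=> h; have [_ /andP[hl hr] _] := h.
have p1 := pihalf_ge1 R.
case: b h => // h _.
  by rewrite gt_eqF // sin_gt0_pihalf // (aims_gt0 FR h).
rewrite -[x.2]opprK sinN oppr_eq0 gt_eqF // sin_gt0_pihalf //.
by rewrite oppr_gt0 (aims_lt0 FR h) ltrNl.
Qed.

Lemma is_diff_Phi b i x : aims C b i x -> derivable f (turn b - x.2) 1 ->
  is_diff x (Phi C (hull C) f)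
    (fun w => (slope b x.2 * w.1 + shear b i x * w.2,
               - (derive1 f (turn b - x.2)) * w.2)).
Proof.
move=> h df; have [_ hx _] := h.
have c0 : cos x.2 != 0 by rewrite gt_eqF // cos_gt0_pihalf.
have df' : is_derive (turn b - x.2) 1 f (derive1 f (turn b - x.2)).
  by rewrite derive1E; exact: derivableP.
have E : \forall y \near x,
    (corner C (target b i) + ((y.1 - corner C i) * slope b y.2 + offset C b i y.2),
     f (turn b - y.2)) = Phi C (hull C) f y.
  near=> y; rewrite (Phi_aims f FR (b := b) (i := i)) //; near: y.
  exact: near_aims.
suff [a [d [da dd Ed]]] : exists a d, [/\ is_derive x.2 1 (slope b) a,
    is_derive x.2 1 (offset C b i) d & (x.1 - corner C i) * a + d = shear b i x].
  have D := is_diff_billiard_branch (corner C (target b i)) (corner C i) da dd df'.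
  have [Dd Dv] := D.
  have := near_eq_is_diff E Dd; rewrite Dv Ed; exact.
have cot : b <> Across ->
    is_derive x.2 1 (fun z => (tan z)^-1) (- (sin x.2) ^-2).
  by move=> bA; apply: is_derive_cot => //; exact: aims_sin_neq0 h bA.
case: b h {df df' E} cot => /= h cot.
- exists 0, (- (len C (ordS i) * cos x.2 ^- 2)); split; last by rewrite mulr0 add0r.
    exact: is_derive_cst.
  apply: (is_derive_eq (is_deriveB (is_derive_cst (len C i) x.2 1)
    (is_deriveZ (len C (ordS i)) (is_derive_tan c0)))).
  by rewrite sub0r.
- have {}cot := cot ltac:(by []).
  exists (- - (sin x.2) ^-2), (len C i * - (sin x.2) ^-2); split.
  + exact: is_deriveN cot.
  + exact: is_deriveZ cot.
  + by rewrite opprK mulrN -mulrBl.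
- have {}cot := cot ltac:(by []).
  exists (- (sin x.2) ^-2), 0; split => //; first exact: is_derive_cst.
  by rewrite addr0 mulrN.
Unshelve. all: by end_near. Qed.

(** Up to the factor cos f(thetabar) / cos thetabar this is a coboundary, which is
    what makes cos theta |ds| an adapted metric. *)
Lemma slope_norm b i x : aims C b i x ->
  `|slope b x.2| = cos x.2 / cos (turn b - x.2).
Proof.
move=> h; have [_ hx _] := h.
have c0 : 0 < cos x.2 by rewrite cos_gt0_pihalf.
case: b h => h /=.
- by rewrite normrN1 sub0r cosN divff // gt_eqF.
- have t0 : 0 < tan x.2 by rewrite tan_gt0E // (aims_gt0 FR h).
  rewrite -[pi / 2 - _]opprB cosN cosBpihalf normrN gtr0_norm ?invr_gt0 //.
  by rewrite /tan invfM invrK mulrC.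
- have t0 : tan x.2 < 0 by rewrite tan_lt0E // (aims_lt0 FR h).
  rewrite -opprD cosN addrC cosDpihalf ltr0_norm ?invr_lt0 //.
  by rewrite /tan invfM invrK mulrC invrN mulrN.
Qed.

(** On the two adjacent branches the denominator sin^2 alone would be too small,
    but the branch condition bounds the distance to the common corner by the width
    times tan |theta|, which cancels one sine. *)
Lemma shear_bound b i x (s0 c0 : R) : aims C b i x -> len C (ordS i) <= 1 ->
  0 < s0 <= `|sin x.2| -> 0 < c0 <= cos x.2 ->
  `|shear b i x| <= (s0 * c0)^-1 + (c0 ^+ 2)^-1.
Proof.
move=> h l1 /andP[s00 hs] /andP[c00 hc]; have [xi hx r] := h.
have cp : 0 < cos x.2 := lt_le_trans c00 hc.
have sp : 0 < `|sin x.2| := lt_le_trans s00 hs.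
have cN : cos x.2 != 0 by rewrite gt_eqF.
have l0 := len_gt0 FR (ordS i).
have key (z : R) : 0 <= z -> z <= len C (ordS i) * (`|sin x.2| / cos x.2) ->
    z / sin x.2 ^+ 2 <= (s0 * c0)^-1 + (c0 ^+ 2)^-1.
  move=> z0 hz; rewrite -[leLHS]addr0; apply: lerD; last by rewrite invr_ge0 sqr_ge0.
  rewrite -real_normK ?num_real // ler_pdivrMr ?exprn_gt0 //.
  apply: (le_trans hz); apply: (@le_trans _ _ (`|sin x.2| / cos x.2)).
    by rewrite ler_piMl // divr_ge0 // ltW.
  have -> : `|sin x.2| / cos x.2 = (`|sin x.2| * cos x.2)^-1 * `|sin x.2| ^+ 2.
    by field; rewrite !gt_eqF.
  rewrite ler_pM2r ?exprn_gt0 // lef_pV2 ?posrE ?mulr_gt0 //.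
  by apply: ler_pM => //; exact: ltW.
have /andP[xl xr] := xi; rewrite cornerSl in xr.
case: b h r => h r /=.
- rewrite normrN ger0_norm; last by rewrite divr_ge0 ?sqr_ge0 // ltW.
  rewrite -[leLHS]add0r; apply: lerD; first by rewrite invr_ge0 mulr_ge0 // ltW.
  rewrite -[leRHS]mul1r; apply: ler_pM; rewrite ?invr_ge0 ?sqr_ge0 //; first exact: ltW.
  by rewrite lef_pV2 ?posrE ?exprn_gt0 // lerXn2r // nnegrE ltW.
- have t0 : 0 < tan x.2 by rewrite tan_gt0E // (aims_gt0 FR h).
  have s1 : 0 < sin x.2 by rewrite tanE // mulr_gt0.
  rewrite normrM (ger0_norm (x := _^-1)) ?invr_ge0 ?sqr_ge0 //.
  move: r; rewrite /reach => r.
  rewrite ltr0_norm; last by lra.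
  by apply: key; rewrite ?gtr0_norm // -/(tan _); lra.
- have t0 : tan x.2 < 0 by rewrite tan_lt0E // (aims_lt0 FR h).
  have s1 : sin x.2 < 0 by rewrite tanE // pmulr_llt0.
  rewrite normrN normrM (ger0_norm (x := _^-1)) ?invr_ge0 ?sqr_ge0 //.
  move: r; rewrite /reach => r.
  rewrite gtr0_norm ?subr_gt0 //.
  by apply: key; rewrite ?ltr0_norm // ?mulNr -/(tan _); lra.
Qed.

End BilliardDifferential.

(** * Contracting reflection laws *)

Section Law.
Context {R : realType}.
Implicit Types (f g : R -> R) (a b l h : R).

(** What the dynamics uses of a reflection law, with the supremum of the derivative
    replaced by a real bound. *)
Record contracting_law f l : Prop := ContractingLaw {
  law_Iangle : forall a, Iangle a -> Iangle (f a);
  law_derivable : forall a, Iangle a -> derivable f a 1;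
  law0 : f 0 = 0;
  law_derive_gt0 : forall a, Iangle a -> 0 < derive1 f a;
  law_derive_le : forall a, Iangle a -> derive1 f a <= l;
  law_rate : 0 < l < 1;
  law_continuous : forall a, Iangle a -> {for a, continuous (derive1 f)} }.

(** The supremum is a real number because it is below 1 and at least f'(0) > 0. *)
Lemma reflection_law_contracting k f : (1 <= k)%N -> reflection_law k f ->
  (forall a, Iangle a -> 0 < derive1 f a) -> exists l, contracting_law f l.
Proof.
move=> k1 [fI [fd fc] _ f0 fl] fpos.
have I0 := @Iangle0 R.
have ub a : Iangle a -> ((derive1 f a)%:E <= lambda f)%E.
  move=> Ia; apply: ereal_sup_ubound; exists a => //.
  by rewrite gtr0_norm // fpos.
have lf : lambda f \is a fin_num.
  rewrite fin_numE; apply/andP; split; apply/eqP => E.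
    by have := ub 0 I0; rewrite E leeNy_eq.
  by move: fl; rewrite E.
have E : (fine (lambda f))%:E = lambda f by rewrite fineK.
exists (fine (lambda f)); split => //.
- by move=> a Ia; apply: (fd 0%N).
- by move=> a Ia; rewrite -lee_fin E; exact: ub.
- apply/andP; split; last by rewrite -lte_fin E.
  by apply: (lt_le_trans (fpos 0 I0)); rewrite -lee_fin E; exact: ub.
- move=> a Ia; case: k k1 fd fc => // -[|k] _ fd fc; first exact: fc.
  by apply/differentiable_continuous/derivable1_diffP; exact: (fd 1%N).
Qed.

Section Contracting.
Variables (f : R -> R) (l : R).
Hypothesis fl : contracting_law f l.

Lemma law_MVT a b : Iangle a -> Iangle b -> a < b ->
  exists2 c, Iangle c & f b - f a = derive1 f c * (b - a).
Proof.
move=> /andP[a1 a2] /andP[b1 b2] ab.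
have sub x : a <= x <= b -> Iangle x.
  by move=> /andP[x1 x2]; apply/andP; split; [exact: lt_le_trans x1|exact: le_lt_trans b2].
have [] := @MVT R f (derive1 f) a b ab.
- move=> x; rewrite in_itv /= => /andP[x1 x2]; rewrite derive1E.
  by apply/derivableP/(law_derivable fl)/sub; rewrite !ltW.
- apply: derivable_within_continuous => x; rewrite in_itv /= => hx.
  by apply: (law_derivable fl); exact: sub.
move=> c; rewrite in_itv /= => /andP[c1 c2] E; exists c => //.
by apply: sub; rewrite !ltW.
Qed.

Lemma law_lt a b : Iangle a -> Iangle b -> a < b -> f a < f b.
Proof.
move=> Ia Ib ab; have [c Ic E] := law_MVT Ia Ib ab.
by rewrite -subr_gt0 E mulr_gt0 ?(law_derive_gt0 fl) // subr_gt0.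
Qed.

Lemma law_le a b : Iangle a -> Iangle b -> a <= b -> f a <= f b.
Proof.
move=> Ia Ib; rewrite le_eqVlt => /predU1P[-> //|ab].
by rewrite ltW // law_lt.
Qed.

Lemma law_gt0 a : Iangle a -> 0 < a -> 0 < f a.
Proof. by move=> Ia; rewrite -{2}(law0 fl) => h; apply: law_lt => //; exact: Iangle0. Qed.

Lemma law_lt0 a : Iangle a -> a < 0 -> f a < 0.
Proof. by move=> Ia; rewrite -{2}(law0 fl) => h; apply: law_lt => //; exact: Iangle0. Qed.

Lemma law_contracts a : Iangle a -> `|f a| <= l * `|a|.
Proof.
move=> Ia; have I0 := @Iangle0 R.
case: (ltgtP a 0) => [a0|a0|->]; last by rewrite (law0 fl) normr0 mulr0.
  rewrite !ltr0_norm ?law_lt0 //; have [c Ic] := law_MVT Ia I0 a0.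
  rewrite (law0 fl) !sub0r => ->; rewrite ler_pM2r ?oppr_gt0 //.
  exact: law_derive_le.
rewrite !gtr0_norm ?law_gt0 //; have [c Ic] := law_MVT I0 Ia a0.
rewrite (law0 fl) !subr0 => ->; rewrite ler_pM2r //.
exact: law_derive_le.
Qed.

(** Stated for a function on [0, pi/2) so that it serves at both ends, through f and
    through a |-> - f(- a). *)
Lemma increasing_left_limit g : (forall a b, 0 <= a -> a < b -> b < pi / 2 -> g a < g b) ->
  (forall a, 0 <= a < pi / 2 -> g a <= l * a) ->
  let L := lim (g x @[x --> (pi / 2 : R)^'-]) in
  [/\ g x @[x --> (pi / 2 : R)^'-] --> L, forall a, 0 <= a < pi / 2 -> g a < L
    & L <= l * (pi / 2)].
Proof.
move=> gm gl L; have p0 : 0 < (pi : R) / 2 by rewrite divr_gt0 // pi_gt0.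
have /andP[l0 _] := law_rate fl.
have up a : 0 <= a < pi / 2 -> g a <= l * (pi / 2).
  by move=> /[dup] h /andP[a0 ap]; rewrite (le_trans (gl _ h)) // ler_pM2l // ltW.
have near0 (z : R) : z < pi / 2 -> \forall x \near (pi / 2 : R)^'-, z < x < pi / 2.
  move=> zp; near=> x; apply/andP; split; near: x.
    exact: nbhs_left_gt.
  exact: nbhs_left_lt.
have cg : cvg (g x @[x --> (pi / 2 : R)^'-]).
  apply: nondecreasing_at_left_is_cvgr.
    near=> x => a b; rewrite !in_itv /= => /andP[xa ap] /andP[xb bp].
    have : 0 < x < pi / 2 by near: x; exact: near0.
    move=> /andP[x0 _]; rewrite le_eqVlt => /predU1P[-> //|ab].
    by rewrite ltW // gm // ltW // (lt_trans x0).
  apply: filterS (near0 0 p0) => x /andP[x0 _].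
  exists (l * (pi / 2)) => y [a /=]; rewrite in_itv /= => /andP[xa ap] <-.
  by apply: up; rewrite ap andbT ltW // (lt_trans x0).
split=> //.
- move=> a /andP[a0 ap]; set b := (a + pi / 2) / 2.
  have ab : a < b by rewrite /b; lra.
  have bp : b < pi / 2 by rewrite /b; lra.
  apply: (lt_le_trans (gm _ _ a0 ab bp)); apply: limr_ge => //.
  near=> x; have : b < x < pi / 2 by near: x; exact: near0.
  by move=> /andP[bx xp]; rewrite ltW // gm // (le_trans a0) // ltW.
- apply: limr_le => //; near=> x.
  have : 0 < x < pi / 2 by near: x; exact: near0.
  by move=> /andP[x0 xp]; apply: up; rewrite xp ltW.
Unshelve. all: by end_near. Qed.

Lemma Iangle_ge0 a : 0 <= a < pi / 2 -> Iangle a.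
Proof.
move=> /andP[a0 ap]; apply/andP; split => //; apply: lt_le_trans a0.
by rewrite oppr_lt0 divr_gt0 // pi_gt0.
Qed.

Lemma fext_right : (forall a, Iangle a -> f a < fext f (pi / 2))
  /\ fext f (pi / 2) <= l * (pi / 2).
Proof.
have p0 : 0 < (pi : R) / 2 by rewrite divr_gt0 // pi_gt0.
have [||_ h1 h2] := @increasing_left_limit f.
- move=> a b a0 ab bp; apply: law_lt => //; apply: Iangle_ge0; apply/andP; split; lra.
- move=> a h; have := law_contracts (Iangle_ge0 h).
  by case/andP: h => a0 _; rewrite (ger0_norm a0); apply: le_trans; exact: ler_norm.
rewrite /fext eqxx; split => // a Ia; have [a0|a0] := leP 0 a.
  by apply: h1; rewrite a0; case/andP: Ia.
apply: (lt_trans (law_lt0 Ia a0)); rewrite -{1}(law0 fl); apply: h1.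
by rewrite lexx.
Qed.

(** Obtained from the right-hand end by conjugation with a |-> - a, under which
    right limits at -pi/2 become left limits at pi/2. *)
Lemma fext_left : (forall a, Iangle a -> fext f (- (pi / 2)) < f a)
  /\ - (l * (pi / 2)) <= fext f (- (pi / 2)).
Proof.
have p0 : 0 < (pi : R) / 2 by rewrite divr_gt0 // pi_gt0.
have [||h0 h1 h2] := @increasing_left_limit (fun a => - f (- a)).
- move=> a b a0 ab bp; rewrite ltrN2; apply: law_lt; last by rewrite ltrN2.
    by apply/IangleN/Iangle_ge0; apply/andP; split; lra.
  by apply/IangleN/Iangle_ge0; apply/andP; split; lra.
- move=> a h; have := law_contracts (IangleN (Iangle_ge0 h)).
  case/andP: h => a0 _; rewrite normrN (ger0_norm a0) -normrN.
  by apply: le_trans; exact: ler_norm.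
have E : fext f (- (pi / 2)) = - lim (- f (- x) @[x --> (pi / 2)^'-]).
  rewrite /fext eqxx ifN; last by rewrite lt_eqF //; lra.
  apply: cvg_lim => //; move/cvg_at_leftNP: h0.
  rewrite (_ : _ \o _ = \- f); last by apply/funext => x /=; rewrite opprK.
  by move=> /cvgN; rewrite (_ : - - f = f) //; apply/funext => x; rewrite !fctE opprK.
rewrite E lerN2; split => // a Ia; have [a0|a0] := ltP 0 a.
  apply: lt_trans (law_gt0 Ia a0); rewrite oppr_lt0.
  by have := h1 0; rewrite oppr0 (law0 fl) oppr0; apply; rewrite lexx.
rewrite ltrNl -{1}[a]opprK; apply: h1; rewrite oppr_ge0 a0 /=.
by case/andP: Ia; rewrite ltrNl.
Qed.

(** An angle f(a) after a collision is strictly below the limit f(pi/2), so after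
    a passage to the right the angle f(pi/2 - f(a)) is strictly above
    f2(f(pi/2)); symmetrically on the left. *)
Lemma theta_tilde_turn a : Iangle a ->
  (0 < f a -> theta_tilde f < f (pi / 2 - f a)) /\
  (f a < 0 -> f (- (pi / 2) - f a) < - theta_tilde f).
Proof.
move=> Ia; have p0 : 0 < (pi : R) / 2 by rewrite divr_gt0 // pi_gt0.
have [hr hrl] := fext_right; have [hl hll] := fext_left.
have /andP[l0 l1] := law_rate fl.
have lp : l * (pi / 2) < pi / 2 by rewrite -[ltRHS]mul1r ltr_pM2r.
have r0 := hr 0 (@Iangle0 R); have l00 := hl 0 (@Iangle0 R).
rewrite (law0 fl) in r0 l00.
have /andP[fa1 fa2] := law_Iangle fl Ia; have fr := hr a Ia; have fll := hl a Ia.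
have E1 : f2 f (fext f (pi / 2)) = f (pi / 2 - fext f (pi / 2)).
  rewrite /f2 gtr0_sg // mul1r {1}/fext ifN ?ifN //.
    by rewrite gt_eqF //; lra.
  by rewrite lt_eqF //; lra.
have E2 : f2 f (fext f (- (pi / 2))) = f (- (pi / 2) - fext f (- (pi / 2))).
  rewrite /f2 ltr0_sg // mulN1r {1}/fext ifN ?ifN //.
    by rewrite gt_eqF //; lra.
  by rewrite lt_eqF //; lra.
rewrite /theta_tilde E1 E2; split => h.
  rewrite gt_min law_lt //; try (apply/andP; split); lra.
rewrite ltrNr gt_min orbC; apply/orP; left; rewrite ltrN2 law_lt //;
  try (apply/andP; split); lra.
Qed.

End Contracting.
End Law.

(** * Divergence of the tangent sums *)

Section Escape.
Context {R : realType}.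
Variables (f : R -> R) (l : R).
Hypothesis fl : contracting_law f l.
Implicit Types (a b : R) (n N : nat).

Lemma f1_law a : Iangle a -> f1 f a = - f a.
Proof.
move=> /andP[a1 a2]; have n1 : a != pi / 2 by rewrite lt_eqF.
have n2 : a != - (pi / 2) by rewrite gt_eqF.
by rewrite /f1 /fext (negPf n1) (negPf n2).
Qed.

Lemma Iangle_iter n a : Iangle a -> Iangle (iter n (f1 f) a).
Proof.
move=> Ia; elim: n => // n IH; rewrite iterS f1_law //.
exact/IangleN/(law_Iangle fl).
Qed.

(** Comparison of moduli for angles of the same sign.  As [f1] is decreasing and
    fixes 0, it exchanges the two alternatives. *)
Definition nested a b : Prop := 0 <= a <= b \/ b <= a <= 0.

Lemma nested_iter n a b : Iangle a -> Iangle b -> nested a b ->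
  nested (iter n (f1 f) a) (iter n (f1 f) b).
Proof.
move=> Ia Ib ab; elim: n => // n IH; rewrite !iterS.
have := Iangle_iter n Ia; have := Iangle_iter n Ib.
move: (iter n _ a) (iter n _ b) IH => a' b' + Ib' Ia'.
rewrite !f1_law // => -[] /andP[h1 h2]; [right|left].
  rewrite lerN2 oppr_le0 (law_le fl Ia' Ib' h2) -(law0 fl).
  by rewrite (law_le fl) //; exact: Iangle0.
rewrite lerN2 oppr_ge0 (law_le fl Ib' Ia' h1) andbT -(law0 fl).
by rewrite (law_le fl) //; exact: Iangle0.
Qed.

Lemma nested_norm a b : nested a b -> `|a| <= `|b|.
Proof.
move=> [] /andP[h1 h2]; first by rewrite !ger0_norm ?(le_trans h1).
by rewrite !ler0_norm ?lerN2 // (le_trans h1).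
Qed.

Lemma Iangle_norm a : Iangle a -> Iangle `|a|.
Proof.
move=> Ia; have [a0|a0] := leP 0 a; first by rewrite ger0_norm.
by rewrite ltr0_norm //; exact: IangleN.
Qed.

Lemma tan_norm_le a b : Iangle a -> Iangle b -> `|a| <= `|b| ->
  tan `|a| <= tan `|b|.
Proof.
move=> Ia Ib; rewrite le_eqVlt => /predU1P[-> //|ab].
by rewrite ltW // ltr_tan ?Iangle_itv //; exact: Iangle_norm.
Qed.

(** The displacement along a channel of unit width during N bounces, when the first
    outgoing angle is -a. *)
Definition tan_sum N a : R := \sum_(0 <= n < N) tan `|iter n (f1 f) a|.

(** Only the first term is compared strictly; the gap tan delta - tan |tau| that
    it leaves is larger than the tail of the series at tau beyond some N.  Every
    later term is at least the corresponding term at tau, by monotonicity. *)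
Lemma escape_side (h tau delta : R) : Iangle tau -> solves_tan_series f h tau ->
  `|tau| < delta < pi / 2 ->
  \forall N \near \oo, forall a, Iangle a -> nested tau a -> delta < `|a| ->
    h^-1 < tan_sum N a.
Proof.
move=> It st /andP[td dp].
have Id : Iangle delta.
  by apply: Iangle_ge0; rewrite dp andbT (le_trans _ (ltW td)).
have gap : tan `|tau| < tan delta.
  by rewrite ltr_tan ?Iangle_itv //; exact: Iangle_norm.
have lt1 : h^-1 - (tan delta - tan `|tau|) < h^-1 by lra.
have := cvgr_gt _ st _ lt1; move=> st'.
near=> N.
have N0 : (0 < N)%N by near: N; exact: nbhs_infty_gt.
have : h^-1 - (tan delta - tan `|tau|) < series (fun n => tan `|iter n (f1 f) tau|) N.
  by near: N; exact: st'.
rewrite /series /= /tan_sum !(big_ltn N0) /= => S a Ia ta da.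
have da' : tan delta < tan `|a|.
  by rewrite ltr_tan ?Iangle_itv //; exact: Iangle_norm.
have : \sum_(1 <= n < N) tan `|iter n (f1 f) tau| <=
    \sum_(1 <= n < N) tan `|iter n (f1 f) a|.
  apply: ler_sum => n _; apply: tan_norm_le; try exact: Iangle_iter.
  exact/nested_norm/nested_iter.
by rewrite (big_ltn N0) /=; lra.
Unshelve. all: by end_near. Qed.

(** The two signs of the starting angle are compared with the two solutions
    separately, as the law is not assumed odd; the number of terms is uniform in
    the starting angle. *)
Lemma escape (h tm tp delta : R) : Iangle tm -> Iangle tp -> tm < 0 < tp ->
  solves_tan_series f h tm -> solves_tan_series f h tp ->
  Num.max (- tm) tp < delta < pi / 2 ->
  exists N, forall a, Iangle a -> delta < `|a| -> h^-1 < tan_sum N a.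
Proof.
move=> Im Ip /andP[m0 p0] sm sp; rewrite gt_max => /andP[/andP[dm dp] d].
have hm := @escape_side h tm delta Im sm; rewrite ltr0_norm // dm d in hm.
have hp := @escape_side h tp delta Ip sp; rewrite gtr0_norm // dp d in hp.
have [N _ HN] : \forall N \near \oo, forall a, Iangle a -> delta < `|a| ->
    h^-1 < tan_sum N a; last by exists N => a; apply: (HN N) => /=.
near=> N => a Ia; have [a0|a0] := leP 0 a => da.
  have H : forall a, Iangle a -> nested tp a -> delta < `|a| -> h^-1 < tan_sum N a.
    by near: N; exact: hp.
  apply: H => //; left; rewrite ltW //=.
  by move: da; rewrite ger0_norm // => da; rewrite ltW // (lt_trans dp).
have H : forall a, Iangle a -> nested tm a -> delta < `|a| -> h^-1 < tan_sum N a.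
  by near: N; exact: hm.
apply: H => //; right; rewrite andbC ltW //=.
by move: da; rewrite ltr0_norm // ltrNr => da; rewrite ltW // (lt_trans da) // ltrNl.
Unshelve. all: by end_near. Qed.

(** The law may be very flat, so the bound comes from monotonicity, one application
    of [f1] at a time, and not from the derivative. *)
Lemma iter_lower_bound (delta : R) N : 0 < delta ->
  exists2 eps, 0 < eps &
  forall n a, (n <= N)%N -> Iangle a -> delta <= `|a| -> eps <= `|iter n (f1 f) a|.
Proof.
have step (e : R) : 0 < e -> exists2 e', 0 < e' &
    forall a, Iangle a -> e <= `|a| -> e' <= `|f1 f a|.
  move=> e0; have [ep|pe] := ltP e (pi / 2); last first.
    exists 1 => // a /Iangle_norm/andP[_ ap] ea.
    by have := le_lt_trans (le_trans pe ea) ap; rewrite ltxx.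
  have Ie : Iangle e by apply: Iangle_ge0; rewrite ltW.
  have INe := IangleN Ie.
  exists (Num.min (f e) (- f (- e))).
    by rewrite lt_min (law_gt0 fl) // oppr_gt0 (law_lt0 fl) // oppr_lt0.
  move=> a Ia; have [a0|a0] := leP 0 a => ea; rewrite f1_law // normrN ge_min.
    rewrite ger0_norm // in ea.
    have a0' := lt_le_trans e0 ea.
    by rewrite gtr0_norm ?(law_gt0 fl) // (law_le fl).
  rewrite ltr0_norm // lerNr in ea.
  by rewrite ltr0_norm ?(law_lt0 fl) // lerN2 (law_le fl) // orbT.
move=> d0; elim: N => [|N [e e0 IH]].
  by exists delta => // n a; rewrite leqn0 => /eqP ->.
have [e' e'0 He] := step e e0.
exists (Num.min e e'); first by rewrite lt_min e0.
move=> n a; rewrite leq_eqVlt => /predU1P[-> Ia da|]; rewrite ge_min; last first.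
  by move=> nN Ia da; rewrite (IH n).
by rewrite iterS (He (iter N (f1 f) a)) ?orbT //; [exact: Iangle_iter|exact: IH].
Qed.

Lemma cos_sub_prod (m d : R) : cos (m - d) - cos (m + d) = 2 * sin m * sin d.
Proof. by rewrite cosB cosD; ring. Qed.

Lemma cos_norm a : cos `|a| = cos a.
Proof. by have [a0|a0] := leP 0 a; [rewrite ger0_norm|rewrite ltr0_norm ?cosN]. Qed.

(** The difference cos (l b) - cos b is 2 sin (m b) sin (d b) with m + d = 1 and
    m - d = l.  Both factors increase with b, so the difference is bounded below
    for b >= eps; the bound is also a bound for the ratio since cos b <= 1. *)
Lemma cos_expansion (eps : R) : 0 < eps -> exists2 nu, 1 < nu &
  forall a, Iangle a -> eps <= `|a| -> nu * cos a <= cos (f a).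
Proof.
move=> e0; have /andP[l0 l1] := law_rate fl.
have p1 := pihalf_ge1 R.
have [ep|pe] := ltP eps (pi / 2); last first.
  exists 2; first by rewrite ltr1n.
  move=> a /Iangle_norm/andP[_ ap] ea.
  by have := le_lt_trans (le_trans pe ea) ap; rewrite ltxx.
pose m := (1 + l) / 2; pose d := (1 - l) / 2.
have m0 : 0 < m by rewrite /m; lra. have d0 : 0 < d by rewrite /d; lra.
have m1 : m < 1 by rewrite /m; lra. have d1 : d < 1 by rewrite /d; lra.
have sub (c b : R) : 0 < c -> c < 1 -> 0 < b -> b < pi / 2 -> 0 < c * b < pi / 2.
  move=> c0 c1 b0 bp; rewrite mulr_gt0 //= (lt_trans _ bp) //.
  by rewrite -[ltRHS]mul1r ltr_pM2r.
have sin_inc (c b : R) : 0 < c -> c < 1 -> eps <= b -> b < pi / 2 ->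
    0 < sin (c * eps) <= sin (c * b).
  move=> c0 c1 eb bp; have /andP[z0 zp] := sub c eps c0 c1 e0 ep.
  have /andP[b0 bq] := sub c b c0 c1 (lt_le_trans e0 eb) bp.
  rewrite sin_gt0_pihalf ?z0 //=.
  have : c * eps <= c * b by rewrite ler_pM2l.
  rewrite le_eqVlt => /predU1P[-> //|zb]; rewrite ltW //.
  by rewrite ltr_sin ?in_itv /=; try (apply/andP; split); lra.
pose del := 2 * sin (m * eps) * sin (d * eps).
have del0 : 0 < del.
  by rewrite /del !mulr_gt0 ?ltr0n //; [have := sin_inc m eps|have := sin_inc d eps];
    rewrite lexx ep => /(_ _ _ isT isT) /andP[].
exists (1 + del); first by lra.
move=> a Ia ea; rewrite -(cos_norm a) -(cos_norm (f a)).
have /andP[_ ap] := Iangle_norm Ia.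
have a0 : 0 < `|a| := lt_le_trans e0 ea.
have c1 : cos `|a| <= 1 by exact: cos_le1.
have E : cos (l * `|a|) - cos `|a| = 2 * sin (m * `|a|) * sin (d * `|a|).
  by rewrite -cos_sub_prod; congr (cos _ - cos _); rewrite /m /d; field.
have /andP[s1 s2] := sin_inc m `|a| m0 m1 ea ap.
have /andP[s3 s4] := sin_inc d `|a| d0 d1 ea ap.
have D : del <= cos (l * `|a|) - cos `|a|.
  rewrite E /del -(mulrA 2) -(mulrA 2 (sin _)) ler_pM2l ?ltr0n //.
  by apply: ler_pM => //; exact: ltW.
have fle := law_contracts fl Ia.
have la : 0 <= l * `|a| < pi / 2.
  have /andP[z1 z2] := sub l `|a| l0 l1 a0 ap; by rewrite (ltW z1).
have mono : cos (l * `|a|) <= cos `|f a|.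
  move: fle; rewrite le_eqVlt => /predU1P[-> //|flt]; rewrite ltW //.
  have nf := normr_ge0 (f a); case/andP: la => la0 lap.
  by rewrite ltr_cos ?in_itv /=; try (apply/andP; split); lra.
rewrite mulrDl mul1r.
have : del * cos `|a| <= del by rewrite ler_piMr // ltW.
lra.
Qed.

End Escape.

(** * Runs between parallel sides, and trapped orbits *)

Section Dynamics.
Context {R : realType} (C : 'I_4 -> (R * R)%type) (f : R -> R) (l h : R).
Hypothesis FR : rect_frame C.
Hypothesis fl : contracting_law f l.
Hypothesis ratio : forall i, len C i / len C (ordS i) <= h^-1.
Hypothesis tilde_gt0 : 0 < theta_tilde f.
Variable Nesc : nat.
Hypothesis escapes : forall a : R, Iangle a -> theta_tilde f < `|a| ->
  h^-1 < tan_sum f Nesc a.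
Notation P := (hull C).
Notation Phi := (Phi C P f).
Implicit Types (i j k : 'I_4) (x y : (R * R)%type) (b : branch) (m : nat).

(** The points whose whole positive orbit is defined. *)
Definition live x : Prop := (M C `\` Ninf C P f) x.

Lemma live_dom x : live x -> dom C P x.
Proof. by move=> [Mx nN]; split => // n1; apply: nN; exists 0%N. Qed.

Lemma live_aims x : live x -> exists b i, aims C b i x.
Proof. by move=> /live_dom/(dom_aims FR). Qed.

Lemma Phi1_inside b i x : aims C b i x -> inside C (target b i) (Phi x).1.
Proof. by move=> h'; rewrite (Phi_aims f FR h') /=; have [] := hit_aims FR h'. Qed.

Lemma Phi2_aims b i x : aims C b i x -> (Phi x).2 = f (turn b - x.2).
Proof. by move=> h'; rewrite (Phi_aims f FR h'). Qed.

Lemma live_Phi x : live x -> live (Phi x).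
Proof.
move=> /[dup] xl [Mx nN]; have [b [i h']] := live_aims xl; split.
  split; first exact: inside_perimeter (Phi1_inside h').
  rewrite (Phi2_aims h'); apply: (law_Iangle fl).
  by have [] := turn_opposite FR h'.
move=> [m _ Nm]; apply: nN; exists m.+1 => //; right; split => //.
exact: live_dom.
Qed.

Lemma live_iter m x : live x -> live (iter m Phi x).
Proof. by move=> xl; elim: m => // m IH; rewrite iterS; exact: live_Phi. Qed.

Lemma aims_inside b i x : aims C b i x -> inside C i x.1.
Proof. by case. Qed.

Lemma aims_side b i j x : inside C i x.1 -> aims C b j x -> j = i.
Proof. by move=> xi [/inside_closed h' _ _]; exact: inside_unique xi h'. Qed.

Definition across x : Prop := exists i, aims C Across i x.

Lemma across_aims i x : inside C i x.1 -> across x -> aims C Across i x.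
Proof. by move=> xi [j h']; rewrite -(aims_side xi h'). Qed.

(** The hypothesis that the angle is a value of f says that the point itself comes
    out of a collision; without it the angle could be close to a right angle and
    the passage would give no lower bound. *)
Lemma adjacent_turn x a : live x -> Iangle a -> x.2 = f a -> ~ across x ->
  theta_tilde f < `|(Phi x).2|.
Proof.
move=> xl Ia xa nx; have [b [i h']] := live_aims xl.
have [hp hm] := theta_tilde_turn fl Ia.
rewrite (Phi2_aims h') xa; case: b h' => h'.
- by case: nx; exists i.
- apply: lt_le_trans (ler_norm _); apply: hp.
  by rewrite -xa; exact: aims_gt0 FR _ _ h'.
- rewrite -normrN; apply: lt_le_trans (ler_norm _); rewrite ltrNr; apply: hm.
  by rewrite -xa; exact: aims_lt0 FR _ _ h'.
Qed.

(** The distance left before the end of the side in the direction of travel.  The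
    opposite side runs backwards and the angle changes sign, so this is the quantity
    that evolves in the same way on both sides of a channel. *)
Definition room i x : R :=
  if 0 <= x.2 then len C i - (x.1 - corner C i) else x.1 - corner C i.

Lemma room_bounds i x : inside C i x.1 -> 0 < room i x < len C i.
Proof.
by move=> /andP[h1 h2]; rewrite cornerSl in h2; rewrite /room; case: ifP => _;
  apply/andP; split; lra.
Qed.

Lemma room_across i x : aims C Across i x -> x.2 != 0 ->
  room (ordS (ordS i)) (Phi x) = room i x - len C (ordS i) * tan `|x.2|.
Proof.
move=> h' x0; have [_ hx _] := h'; have Ix := IangleN hx.
have E1 : (Phi x).1 - corner C (ordS (ordS i)) =
    len C i - (x.1 - corner C i) - len C (ordS i) * tan x.2.
  by rewrite (Phi_aims f FR h') /= /landing /=; ring.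
rewrite /room E1 (Phi2_aims h') /= sub0r (len_opp FR).
case: (ltgtP x.2 0) x0 => // s0 _.
  rewrite ifT; last by rewrite ltW // (law_gt0 fl) // oppr_gt0.
  by rewrite ltr0_norm // tanN; ring.
rewrite ifF; last by apply/negbTE; rewrite -ltNge (law_lt0 fl) // oppr_lt0.
by rewrite gtr0_norm.
Qed.

Lemma tan_sumS m (a : R) :
  tan_sum f m.+1 a = tan `|a| + tan_sum f m (f1 f a).
Proof.
rewrite /tan_sum big_nat_recl //=; congr (_ + _).
by apply: eq_bigr => k _; rewrite -iterS iterSr.
Qed.

Lemma Phi2_across x : across x -> - (Phi x).2 = f1 f (- x.2).
Proof.
move=> [i h']; have [_ hx _] := h'.
by rewrite (Phi2_aims h') (f1_law f (IangleN hx)) sub0r.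
Qed.

Lemma across_run_angle m x : (forall p, (p < m)%N -> across (iter p Phi x)) ->
  - (iter m Phi x).2 = iter m (f1 f) (- x.2).
Proof.
elim: m => // m IH hm; rewrite !iterS Phi2_across; last exact: hm (ltnSn m).
by rewrite IH // => k km; apply: hm; rewrite ltnW.
Qed.

(** Each bounce uses up w tan |theta_n| of the room, and the room stays positive. *)
Lemma across_run_room m i x : inside C i x.1 -> x.2 != 0 ->
  (forall p, (p < m)%N -> across (iter p Phi x)) ->
  len C (ordS i) * tan_sum f m (- x.2) < room i x.
Proof.
elim: m i x => [|m IH] i x xi x0 hm.
  by rewrite /tan_sum big_geq // mulr0; case/andP: (room_bounds xi).
have h' := across_aims xi (hm 0%N isT).
have [_ hx _] := h'; have Ix := IangleN hx.
have y0 : (Phi x).2 != 0.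
  rewrite (Phi2_aims h') /= sub0r; case: (ltgtP x.2 0) x0 => // s0 _.
    by rewrite gt_eqF // (law_gt0 fl) // oppr_gt0.
  by rewrite lt_eqF // (law_lt0 fl) // oppr_lt0.
have := IH _ _ (Phi1_inside h') y0; rewrite /= (room_across h' x0).
rewrite (len_opp FR (ordS i)) Phi2_across; last exact: hm 0%N isT.
move=> H; rewrite tan_sumS mulrDr normrN -ltrBrDl; apply: H => k km.
by rewrite -iterSr; exact: hm.
Qed.

(** The room on a side of length len is at most len, so a run requires
    w times the tangent sum to stay below len, that is, the sum below
    len / w <= 1/h. *)
Lemma across_run_escapes x : live x -> theta_tilde f < `|x.2| ->
  ~ (forall p, (p < Nesc)%N -> across (iter p Phi x)).
Proof.
move=> xl tx hm; have [b [i [xi Ix _]]] := live_aims xl.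
have x0 : x.2 != 0 by rewrite -normr_gt0 (lt_trans tilde_gt0).
have := across_run_room xi x0 hm; have /andP[_] := room_bounds xi.
have l2 := len_gt0 FR (ordS i).
move=> h1 h2; have := lt_trans h2 h1; rewrite mulrC -ltr_pdivlMr // => h3.
have e := escapes (IangleN Ix); rewrite normrN in e.
by have := lt_le_trans (lt_trans (e tx) h3) (ratio i); rewrite ltxx.
Qed.

Lemma side_len i : side C i = len C i *: dir C i.
Proof. by rewrite /dir scalerA divff ?scale1r // gt_eqF // (len_gt0 FR). Qed.

Lemma ordS_neq i : [/\ ordS i != i, ordS (ordS i) != i & ordS (ordS (ordS i)) != i].
Proof. by case: i => [[|[|[|[|//]]]] hi]. Qed.

Lemma parallel_sides i j : i != j ->
  crossp (side C i) (side C j) = 0 <-> j = ordS (ordS i).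
Proof.
move=> ij; have l0 := len_gt0 FR; have ne k := lt0r_neq0 (l0 k).
have u := dir_unit FR i.
have cr k : crossp (side C i) (side C k) =
    len C i * len C k * dotp (inward C i) (dir C k).
  rewrite !side_len /inward /rot90 /crossp /dotp /=.
  by rewrite /GRing.scale /= /GRing.scale /=; ring.
rewrite cr; split.
  move=> /eqP; rewrite !mulf_eq0 !(negPf (ne _)) /=.
  case: (ord4P i j) ij => -> //; first by rewrite eqxx.
  - by rewrite (dir_turn FR) dot_inward // oner_eq0.
  - by rewrite (dir_opp FR) (dir_turn FR) dotpN dot_inward // oppr_eq0 oner_eq0.
by move=> ->; rewrite (dir_opp FR) dotpN dot_dir oppr0 mulr0.
Qed.

(** Consecutive collisions on two parallel sides are exactly crossings of the
    channel, because a branch never lands on the side it starts from.  The crossing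
    out of x itself is not constrained, whence the positive index. *)
Lemma T_across x : T C P f x <->
  live x /\ forall m, (0 < m)%N -> across (iter m Phi x).
Proof.
split.
  move=> [xl [i [j [ij cij H]]]]; split=> // m m0.
  have Ej := (parallel_sides ij).1 cij.
  have [b [k h']] := live_aims (live_iter m xl).
  have Hk k' y : inside C k' y.1 -> on_side C i y \/ on_side C j y ->
      k' = i \/ k' = ordS (ordS i).
    by rewrite Ej => yk [] /(inside_unique yk) ->; [left|right].
  have k1 := Hk _ _ (aims_inside h') (H m m0).
  have k2 := Hk _ _ (Phi1_inside h') (H m.+1 isT).
  have [n1 n2 n3] := ordS_neq i.
  case: b h' k2 => h' k2; first by exists k.
  - case: k1 k2 => -> /= [] E.
    + by rewrite E eqxx in n1.
    + by move/ordS_inj: E n1 => <-; rewrite eqxx.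
    + by rewrite E eqxx in n3.
    + by move/ordS_inj/ordS_inj: E n1 => ->; rewrite eqxx.
  - case: k1 k2 => -> /=; rewrite ?ordS4 => -[] E.
    + by rewrite E eqxx in n3.
    + by move/ordS_inj/ordS_inj: E n1 => ->; rewrite eqxx.
    + by rewrite E eqxx in n1.
    + by move/ordS_inj: E n1 => <-; rewrite eqxx.
move=> [xl H]; split => //.
have [_ [i [xi _ _]]] := live_aims (live_Phi xl).
have [_ n2 _] := ordS_neq i.
exists i, (ordS (ordS i)); split; first by rewrite eq_sym.
  by apply/parallel_sides; rewrite // eq_sym.
move=> [//|m] _; suff : inside C i (iter m.+1 Phi x).1 \/
    inside C (ordS (ordS i)) (iter m.+1 Phi x).1.
  by case=> /inside_closed; [left|right].
elim: m => [|m IH]; first by left.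
have a := H m.+1 isT; rewrite iterS; case: IH => IH.
  by right; exact: Phi1_inside (across_aims IH a).
by left; rewrite -{1}(ordS4 i); exact: Phi1_inside (across_aims IH a).
Qed.

(** If x were not trapped, Phi x would leave for an adjacent side.  As Phi x comes
    out of a collision, the next angle is beyond theta_tilde, and the endless run
    that follows contradicts the escape bound. *)
Lemma trapped_pullback x : live x -> T C P f (Phi x) -> T C P f x.
Proof.
move=> xl /T_across[_ H]; apply/T_across; split=> // -[//|[|m]] _; last first.
  by rewrite iterSr; exact: H.
rewrite /=; apply: contrapT => na; have [b [i h']] := live_aims xl.
have [Ia _] := turn_opposite FR h'.
have tt := adjacent_turn (live_Phi xl) Ia (Phi2_aims h') na.
apply: (across_run_escapes (live_Phi (live_Phi xl)) tt).
by move=> p _; have := H p.+1 isT; rewrite iterSr.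
Qed.

Lemma Mhat_live x : Mhat C P f x <-> live x /\ ~ T C P f x.
Proof.
split; first by move=> [Mx n]; split; [split=> // ?; apply: n; right|move=> ?; apply: n; left].
by move=> [[Mx nN] nT]; split => // -[].
Qed.

Lemma Mhat_forward : Phi @` Mhat C P f `<=` Mhat C P f.
Proof.
move=> _ [x /Mhat_live[xl nT] <-]; apply/Mhat_live; split; first exact: live_Phi.
by move=> /(trapped_pullback xl).
Qed.

End Dynamics.

(** * Orbits of period two and their basin *)

Section Basin.
Context {R : realType} (C : 'I_4 -> (R * R)%type) (f : R -> R) (l h : R).
Hypothesis FR : rect_frame C.
Hypothesis fl : contracting_law f l.
Hypothesis ratio : forall i, len C i / len C (ordS i) <= h^-1.
Hypothesis tilde_gt0 : 0 < theta_tilde f.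
Variable Nesc : nat.
Hypothesis escapes : forall a : R, Iangle a -> theta_tilde f < `|a| ->
  h^-1 < tan_sum f Nesc a.
Notation P := (hull C).
Notation Phi := (Phi C P f).
Implicit Types (i j : 'I_4) (x y : (R * R)%type) (b : branch) (m : nat).

Lemma perp_across i x : inside C i x.1 -> x.2 = 0 -> aims C Across i x.
Proof.
move=> xi x0; split => //; rewrite ?x0; first exact: Iangle0.
rewrite /reach x0 tan0 mulr0 addr0; move: xi; rewrite /inside cornerSl.
by move=> /andP[h1 h2]; apply/andP; split; lra.
Qed.

(** A perpendicular ray returns along itself. *)
Lemma perp_period2 i x : inside C i x.1 -> x.2 = 0 -> period2 C P f x.
Proof.
move=> xi x0; have h1 := perp_across xi x0.
have E1 := Phi_aims f FR h1.
have y0 : (Phi x).2 = 0 by rewrite E1 /= x0 subr0 (law0 fl).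
have h2 := perp_across (Phi1_inside f FR h1) y0.
have E2 := Phi_aims f FR h2.
split.
- by apply/(dom_aims FR); exists Across, i.
- by apply/(dom_aims FR); exists Across, (ordS (ordS i)).
- have L j y : y.2 = 0 ->
      landing C Across j y = corner C (ordS (ordS j)) + (len C j - (y.1 - corner C j)).
    by move=> yj; rewrite landing_across /reach yj tan0; ring.
  rewrite E2 (L _ _ y0) y0 {1}E1 (L _ _ x0) subr0 (law0 fl) ordS4 (len_opp FR).
  by rewrite [RHS]surjective_pairing x0; congr pair; rewrite /=; ring.
- apply/eqP => E; have := Phi1_inside f FR h1; rewrite E => xi2.
  have := inside_unique xi (inside_closed xi2); have [_ + _] := ordS_neq i.
  by move=> /eqP.
Qed.

(** A point of period two cannot start on an adjacent branch: after a passage to the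
    right the angle is positive, hence the next branch is not Leftward and does not
    lead back.  If it crosses the channel twice, two contractions fix the angle,
    which therefore vanishes. *)
Lemma period2_perp x : period2 C P f x -> x.2 = 0.
Proof.
move=> [/(dom_aims FR)[b [i h1]] /(dom_aims FR)[b' [j h2]] E _].
have [xi hx _] := h1.
have jE : j = target b i.
  by apply: (inside_unique (Phi1_inside f FR h1)); exact/inside_closed/(aims_inside h2).
have iE : target b' j = i.
  apply: (inside_unique xi); apply: inside_closed.
  by have := Phi1_inside f FR h2; rewrite E.
have [n1 n2 n3] := ordS_neq i; have [_ Iy _] := h2.
have E2 := Phi2_aims f FR h1.
subst j; case: b h1 h2 iE E2 => h1 h2 iE E2.
- have b'E : b' = Across.
    case: b' h2 iE => //= _ /eqP; first by rewrite (negPf n3).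
    by rewrite ordS4 (negPf n1).
  subst b'; have := Phi2_aims f FR h2; rewrite E E2 /= !sub0r => H.
  rewrite E2 /= sub0r in Iy.
  have c1 := law_contracts fl (IangleN Iy).
  have c2 := law_contracts fl (IangleN hx).
  rewrite -H in c1; rewrite !normrN in c1 c2.
  have /andP[l0 l1] := law_rate fl; have n0 := normr_ge0 x.2.
  apply/eqP; rewrite -normr_eq0; apply/eqP/le_anti; rewrite n0 andbT.
  have c3 := le_trans c1 (ler_wpM2l (ltW l0) c2).
  have : l * (l * `|x.2|) <= l * `|x.2|.
    by rewrite ler_wpM2l ?(ltW l0) // ler_piMl // ltW.
  move=> c4; have := le_trans c3 c4; rewrite -subr_le0 -{1}[`|_|]mul1r -mulrBl.
  by rewrite pmulr_rle0 // subr_gt0.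
- have y0 : 0 < (Phi x).2.
    rewrite E2; have [Ia _] := turn_opposite FR h1; apply: (law_gt0 fl) => //=.
    by case/andP: hx => _; rewrite subr_gt0.
  case: b' h2 iE => /= h2 /eqP; rewrite ?ordS4 ?(negPf n3) ?(negPf n2) // => _.
  by have := aims_lt0 FR h2; rewrite ltNge ltW.
- have y0 : (Phi x).2 < 0.
    rewrite E2; have [Ia _] := turn_opposite FR h1; apply: (law_lt0 fl) => //=.
    by case/andP: hx => + _; rewrite subr_lt0.
  case: b' h2 iE => /= h2 /eqP; rewrite ?ordS4 ?(negPf n1) ?(negPf n2) // => _.
  by have := aims_gt0 FR h2; rewrite ltNge ltW.
Qed.

(** The period-two points have angle 0, so the angle bounds the distance to them
    from below; [eucl_dist_le] is the converse bound, as every perpendicular ray from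
    the interior of a side has period two. *)
Lemma eucl_dist_ge x : ((`|x.2|)%:E <= eucl_dist x (period2 C P f))%E.
Proof.
apply: le_ereal_inf_tmp => _ [a /period2_perp a0 <-]; rewrite lee_fin.
by apply: le_trans (ler_norm2_enorm _); rewrite /= a0 subr0.
Qed.

Lemma eucl_dist_le i x : inside C i x.1 ->
  (eucl_dist x (period2 C P f) <= (`|x.2|)%:E)%E.
Proof.
move=> xi; apply: ereal_inf_le; exists (enorm (x - (x.1, 0)))%:E.
  by exists (x.1, 0) => //; exact: (@perp_period2 i).
by rewrite lee_fin (le_trans (enorm_le _)) //= subrr normr0 add0r subr0.
Qed.

Lemma across_contracts x : across C x -> `|(Phi x).2| <= l * `|x.2|.
Proof.
move=> [i h']; have [_ hx _] := h'; rewrite (Phi2_aims f FR h') sub0r -(normrN x.2).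
exact: (law_contracts fl (IangleN hx)).
Qed.

(** For the inclusion in T, argue by contradiction: an orbit that starts outside T
    stays outside, by forward invariance, so it keeps passing between adjacent
    sides, and each passage is followed by an angle beyond theta_tilde. *)
Lemma basin_T : basin C P f (period2 C P f) = T C P f.
Proof.
have /andP[l0 l1] := law_rate fl.
apply/seteqP; split=> x.
  move=> [xl /fine_cvgP[fin cv]]; apply: contrapT => nT.
  have : Mhat C P f x by apply/Mhat_live.
  have [m0 _ Hm0] : \forall m \near \oo, `|(iter m Phi x).2| < theta_tilde f.
    near=> m.
    have d0 : eucl_dist (iter m Phi x) (period2 C P f) \is a fin_num by near: m.
    rewrite -lte_fin; apply: (le_lt_trans (eucl_dist_ge _)); rewrite -(fineK d0) lte_fin.
    by near: m; exact: (cvgr_lt _ cv).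
  have Mm m : Mhat C P f x -> Mhat C P f (iter m Phi x).
    move=> Mx; elim: m => // m IH; rewrite iterS.
    by apply: (Mhat_forward FR fl ratio tilde_gt0 escapes); exists (iter m Phi x).
  move=> /(Mm m0)/Mhat_live[_]; apply; apply/(T_across FR fl); split.
    exact: live_iter FR fl _ _ xl.
  move=> [//|m] _; rewrite -iterD addSn; apply: contrapT => na.
  have zl : live C f (iter (m + m0) Phi x) by exact: live_iter FR fl _ _ xl.
  have [b [i h1]] := live_aims FR zl; have [Ia _] := turn_opposite FR h1.
  have := adjacent_turn FR fl (live_Phi FR fl zl) Ia (Phi2_aims f FR h1) na.
  rewrite -!iterS; apply/negP; rewrite -leNgt ltW //; apply: Hm0 => /=.
  by rewrite -!addSn leq_addl.
move=> /(T_across FR fl)[xl H]; split => //.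
have bnd m : `|(iter m.+1 Phi x).2| <= l ^+ m * `|(Phi x).2|.
  elim: m => [|m IH]; first by rewrite expr0 mul1r.
  rewrite iterS exprS -mulrA; apply: le_trans (across_contracts _) _; first exact: H.
  by rewrite ler_wpM2l // ltW.
have lo : \forall m \near \oo, (cst 0 m <= eucl_dist (iter m.+1 Phi x) (period2 C P f)
    <= (l ^+ m * `|(Phi x).2|)%:E)%E.
  near=> m; rewrite (le_trans _ (eucl_dist_ge _)) ?lee_fin //=.
  have [_ [i [zi _ _]]] := live_aims FR (live_iter FR fl m.+1 xl).
  by apply: (le_trans (eucl_dist_le zi)); rewrite lee_fin; exact: bnd.
have hi : (l ^+ m * `|(Phi x).2|)%:E @[m --> \oo] --> 0%:E.
  apply: cvg_EFin; first by near=> m.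
  rewrite /comp /= -[X in _ --> X](mul0r `|(Phi x).2|); apply: cvgM; last exact: cvg_cst.
  by apply: cvg_expr; rewrite ger0_norm // ltW.
have := squeeze_cvge lo (cvg_cst _) hi.
rewrite (cvg_shiftS (fun m => eucl_dist (iter m Phi x) (period2 C P f))).
exact.
Unshelve. all: by end_near. Qed.

End Basin.

(** * Hyperbolicity of triangular cocycles *)

Section GeometricSequences.
Context {R : realType}.
Variables (u : R ^nat) (K l : R).
Hypotheses (l0 : 0 < l) (l1 : l < 1) (uK : forall n, `|u n.+1 - u n| <= K * l ^+ n).

Lemma geometric_increments_dist n k : `|u (n + k)%N - u n| <= K / (1 - l) * l ^+ n.
Proof.
have K0 : 0 <= K by have := uK 0; rewrite expr0 mulr1; apply: le_trans.
have dl : 0 < 1 - l by rewrite subr_gt0.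
suff : `|u (n + k)%N - u n| <= K / (1 - l) * l ^+ n * (1 - l ^+ k).
  move=> /le_trans; apply; rewrite ler_piMr //.
    by rewrite mulr_ge0 ?divr_ge0 ?exprn_ge0 // ltW.
  by rewrite gerBl exprn_ge0 // ltW.
elim: k => [|k IH]; first by rewrite addn0 !subrr normr0 mulr0.
have -> : u (n + k.+1)%N - u n = (u (n + k).+1 - u (n + k)%N) + (u (n + k)%N - u n).
  by rewrite addnS addrA subrK.
rewrite (le_trans (ler_normD _ _)) // (le_trans (lerD (uK _) IH)) //.
rewrite exprD exprS le_eqVlt; apply/orP; left; apply/eqP.
by field; rewrite gt_eqF.
Qed.

Lemma geometric_increments_cvg : cvgn u.
Proof.
have K0 : 0 <= K by have := uK 0; rewrite expr0 mulr1; apply: le_trans.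
have dl : 0 < 1 - l by rewrite subr_gt0.
apply: cauchy_cvg; apply: cauchy_exP => e e0.
have : K / (1 - l) * l ^+ n @[n --> \oo] --> 0.
  rewrite -[X in _ --> X](mulr0 (K / (1 - l))); apply: cvgMl_tmp.
  by apply: cvg_expr; rewrite ger0_norm // ltW.
move=> /cvgrPdist_lt/(_ _ e0) [N _ HN].
exists (u N); exists N => // n /= Nn; rewrite /ball /= distrC -(subnKC Nn).
apply: le_lt_trans (geometric_increments_dist N _) _.
have := HN N (leqnn N); rewrite sub0r normrN ger0_norm //.
by rewrite mulr_ge0 ?divr_ge0 ?exprn_ge0 // ltW.
Qed.

Lemma geometric_increments_lim n : `|u n - limn u| <= K / (1 - l) * l ^+ n.
Proof.
have c := geometric_increments_cvg.
have cd : `|u n - u m| @[m --> \oo] --> `|u n - limn u|.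
  by apply: cvg_norm; apply: cvgB; [exact: cvg_cst|].
rewrite -(cvg_lim (@Rhausdorff R) cd).
apply: limr_le; first by apply/cvg_ex; exists `|u n - limn u|.
near=> m; rewrite distrC.
have nm : (n <= m)%N by near: m; exact: nbhs_infty_ge.
by rewrite -(subnKC nm); exact: geometric_increments_dist.
Unshelve. all: by end_near. Qed.

End GeometricSequences.

(** An abstract criterion, for a map with triangular differential over an invariant
    set S.  The first coordinate is expanded by nu in the metric rho |ds|, where
    rho is bounded away from 0; the second is contracted by l. *)
Section SkewProduct.
Context {R : realType} {n : nat}.
Variables (C : 'I_n.+1 -> (R * R)%type) (P : set (R * R)) (f : R -> R).
Variable S : set (R * R).
Variables (al be ga rho : R * R -> R) (r0 nu l B : R).
Notation Phi := (Phi C P f).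
Implicit Types (x w : (R * R)%type) (m : nat).

Definition continuous_on (g : R * R -> R) : Prop :=
  forall x, S x -> g y @[y --> within S (nbhs x)] --> g x.

Hypothesis SPhi : forall x, S x -> S (Phi x).
Hypothesis dPhi : forall x, S x ->
  is_diff x Phi (fun w => (al x * w.1 + be x * w.2, ga x * w.2)).
Hypothesis al_cont : continuous_on al.
Hypothesis be_cont : continuous_on be.
Hypothesis ga_cont : continuous_on ga.
Hypothesis al_neq0 : forall x, S x -> al x != 0.
Hypothesis ga_neq0 : forall x, S x -> ga x != 0.
Hypothesis r0_gt0 : 0 < r0.
Hypothesis rho_bounds : forall x, S x -> r0 <= rho x <= 1.
Hypothesis nu_gt1 : 1 < nu.
Hypothesis expansion : forall x, S x -> nu * rho x <= `|al x| * rho (Phi x).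
Hypothesis l01 : 0 < l < 1.
Hypothesis contraction : forall x, S x -> `|ga x| <= l.
Hypothesis B_ge0 : 0 <= B.
Hypothesis be_bound : forall x, S x -> `|be x| <= B.

Fixpoint al_iter m x : R := if m is m'.+1 then al (iter m' Phi x) * al_iter m' x else 1.
Fixpoint ga_iter m x : R := if m is m'.+1 then ga (iter m' Phi x) * ga_iter m' x else 1.
Fixpoint be_iter m x : R :=
  if m is m'.+1 then
    al (iter m' Phi x) * be_iter m' x + be (iter m' Phi x) * ga_iter m' x
  else 0.

Lemma S_iter m x : S x -> S (iter m Phi x).
Proof. by move=> Sx; elim: m => // m IH; rewrite iterS; exact: SPhi. Qed.

Lemma is_diff_iter m x : S x ->
  is_diff x (iter m Phi)
    (fun w => (al_iter m x * w.1 + be_iter m x * w.2, ga_iter m x * w.2)).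
Proof.
move=> Sx; elim: m => [|m IH].
  apply: (is_diff_eq (is_diff_id x)); apply/funext => -[a b] /=.
  by rewrite !mul1r mul0r addr0.
have D := is_diff_comp IH (dPhi (S_iter m Sx)).
apply: (is_diff_eq D); apply/funext => -[a b] /=.
by congr pair; ring.
Qed.

Lemma al_iter_neq0 m x : S x -> al_iter m x != 0.
Proof.
move=> Sx; elim: m => [|m IH] /=; first exact: oner_neq0.
by rewrite mulf_neq0 // al_neq0 //; exact: S_iter.
Qed.

Lemma ga_iter_neq0 m x : S x -> ga_iter m x != 0.
Proof.
move=> Sx; elim: m => [|m IH] /=; first exact: oner_neq0.
by rewrite mulf_neq0 // ga_neq0 //; exact: S_iter.
Qed.

Lemma ga_iter_le m x : S x -> `|ga_iter m x| <= l ^+ m.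
Proof.
move=> Sx; elim: m => [|m IH] /=; first by rewrite normr1.
by rewrite normrM exprS ler_pM // contraction //; exact: S_iter.
Qed.

Lemma al_iter_ge m x : S x -> r0 * nu ^+ m <= `|al_iter m x|.
Proof.
move=> Sx; have nu0 : 0 < nu := lt_trans ltr01 nu_gt1.
have H : nu ^+ m * rho x <= `|al_iter m x| * rho (iter m Phi x).
  elim: m => [|m IH]; first by rewrite normr1.
  rewrite iterS /= normrM exprS -mulrA.
  apply: (le_trans (ler_wpM2l (ltW nu0) IH)).
  rewrite mulrCA [leRHS]mulrAC mulrC ler_wpM2r //.
  exact: expansion (S_iter m Sx).
have /andP[rx _] := rho_bounds Sx; have /andP[_ ry] := rho_bounds (S_iter m Sx).
rewrite mulrC; apply: le_trans (le_trans _ H) _.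
  by rewrite ler_wpM2l // exprn_ge0 // ltW.
by rewrite ler_piMr.
Qed.

(** The graph transform: pulling back the vertical line by the m-th iterate gives
    lines spanned by (slope, 1), and one step of the pull-back is this recursion.
    Its limit spans the stable direction. *)
Fixpoint slope_approx m x : R :=
  if m is m'.+1 then (ga x * slope_approx m' (Phi x) - be x) / al x else 0.

(** The increments satisfy a linear recursion with factor ga / al, so after
    multiplication by rho they decay at least like l^m, uniformly on S. *)
Lemma slope_approx_step m x : S x ->
  `|slope_approx m.+1 x - slope_approx m x| <= B / r0 ^+ 2 * l ^+ m.
Proof.
move=> Sx; have /andP[l0 l1] := l01.
have rho_gt0 y : S y -> 0 < rho y.
  by move=> /rho_bounds/andP[+ _]; exact: lt_le_trans.
have al_inv y : S y -> rho y / `|al y| <= rho (Phi y).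
  move=> Sy; rewrite ler_pdivrMr ?normr_gt0 ?al_neq0 // mulrC.
  apply: le_trans (expansion Sy); rewrite ler_peMl ?ltW //.
  exact: rho_gt0.
have H : forall y, S y ->
    rho y * `|slope_approx m.+1 y - slope_approx m y| <= B * l ^+ m.
  elim: m => [|m IH] y Sy.
    rewrite expr0 mulr1 subr0 /= mulr0 sub0r normrM normrN normfV mulrCA mulrC.
    have /andP[_ r1] := rho_bounds (SPhi Sy).
    rewrite -[leRHS]mul1r ler_pM //.
    - by rewrite divr_ge0 // ltW // rho_gt0.
    - exact: le_trans (al_inv _ Sy) r1.
    - exact: be_bound.
  have -> : slope_approx m.+2 y - slope_approx m.+1 y =
      ga y * (slope_approx m.+1 (Phi y) - slope_approx m (Phi y)) / al y.
    rewrite -[slope_approx m.+2 y]/((ga y * slope_approx m.+1 (Phi y) - be y) / al y).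
    rewrite -[X in _ - X = _]/((ga y * slope_approx m (Phi y) - be y) / al y).
    by rewrite -mulrBl; congr (_ / _); rewrite opprB addrA subrK mulrBr.
  rewrite !normrM normfV exprS.
  set d := `|_ - _|; have d0 : 0 <= d by exact: normr_ge0.
  have -> : rho y * (`|ga y| * d / `|al y|) = `|ga y| * (rho y / `|al y| * d) by ring.
  rewrite [leRHS]mulrCA; apply: ler_pM => //; first last.
  - by apply: le_trans (IH _ (SPhi Sy)); rewrite ler_wpM2r // al_inv.
  - exact: contraction.
  by rewrite mulr_ge0 // divr_ge0 // ltW // rho_gt0.
have /andP[rx r1] := rho_bounds Sx; have r00 : r0 <= 1 := le_trans rx r1.
have := H x Sx; rewrite mulrC -ler_pdivlMr ?rho_gt0 // => /le_trans; apply.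
rewrite mulrAC; apply: ler_wpM2r; first by rewrite exprn_ge0 // ltW.
apply: ler_wpM2l => //; rewrite lef_pV2 ?posrE ?exprn_gt0 ?rho_gt0 //.
by apply: le_trans rx; rewrite expr2 ler_piMr // ltW.
Qed.

Definition stable_slope x : R := limn (slope_approx ^~ x).

Let K := B / r0 ^+ 2.

Lemma slope_approx_cvg x : S x -> slope_approx ^~ x @ \oo --> stable_slope x.
Proof.
move=> Sx; have /andP[l0 l1] := l01.
exact: (geometric_increments_cvg l0 l1 (fun m => slope_approx_step m Sx)).
Qed.

Lemma slope_approx_dist m x : S x ->
  `|slope_approx m x - stable_slope x| <= K / (1 - l) * l ^+ m.
Proof.
move=> Sx; have /andP[l0 l1] := l01.
exact: (geometric_increments_lim l0 l1 (fun m => slope_approx_step m Sx)).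
Qed.

Lemma stable_slope_bound x : S x -> `|stable_slope x| <= K / (1 - l).
Proof.
by move=> /(slope_approx_dist 0); rewrite expr0 mulr1 sub0r normrN.
Qed.

(** The limit of the recursion that defines the approximations. *)
Lemma stable_slope_invariant x : S x ->
  al x * stable_slope x + be x = ga x * stable_slope (Phi x).
Proof.
move=> Sx.
have c1 : slope_approx m.+1 x @[m --> \oo] --> stable_slope x.
  by have := slope_approx_cvg Sx; rewrite -cvg_shiftS.
have c2 : slope_approx m.+1 x @[m --> \oo] -->
    (ga x * stable_slope (Phi x) - be x) / al x.
  apply: cvgM; last exact: cvg_cst.
  apply: cvgB; last exact: cvg_cst.
  by apply: cvgM; [exact: cvg_cst|exact: slope_approx_cvg (SPhi Sx)].
rewrite (cvg_unique _ c1 c2) // mulrC mulfVK ?al_neq0 // subrK //.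
Qed.

Lemma slope_approx_continuous m : continuous_on (slope_approx m).
Proof.
elim: m => [|m IH] x Sx; first exact: cvg_cst.
have cPhi : Phi y @[y --> within S (nbhs x)] --> within S (nbhs (Phi x)).
  move=> A; rewrite /within /= => hA.
  have cP : {for x, continuous Phi}.
    by have [dx _] := dPhi Sx; exact: differentiable_continuous.
  have h : nbhs x (Phi @^-1` [set y | S y -> A y]) := cP _ hA.
  suff : nbhs x [set y | S y -> A (Phi y)] by [].
  by apply: filterS h => y hy Sy; exact: hy (SPhi Sy).
apply: cvgM; last exact: cvgV (al_neq0 Sx) (al_cont Sx).
apply: cvgB; last exact: be_cont.
apply: cvgM; first exact: ga_cont.
exact: cvg_comp cPhi (IH _ (SPhi Sx)).
Qed.

(** A uniform limit, on S, of functions that are continuous relative to S. *)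
Lemma stable_slope_continuous : continuous_on stable_slope.
Proof.
move=> x Sx; have /andP[l0 l1] := l01; apply/cvgrPdist_lt => e e0.
have : K / (1 - l) * l ^+ m @[m --> \oo] --> 0.
  rewrite -[X in _ --> X](mulr0 (K / (1 - l))); apply: cvgMl_tmp.
  by apply: cvg_expr; rewrite ger0_norm // ltW.
have e3 : 0 < e / 3 by rewrite divr_gt0.
move=> /cvgrPdist_lt/(_ _ e3) [m _ /(_ m (leqnn m))].
rewrite sub0r normrN => /(le_lt_trans (ler_norm _)) hm.
have /cvgrPdist_lt/(_ _ e3) cm := @slope_approx_continuous m x Sx.
have Sn : \forall y \near within S (nbhs x), S y by exact: withinT.
near=> y.
have Sy : S y by near: y.
have h1 : `|slope_approx m x - slope_approx m y| < e / 3 by near: y.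
have h2 := le_lt_trans (slope_approx_dist m Sx) hm.
have h3 := le_lt_trans (slope_approx_dist m Sy) hm.
rewrite distrC in h2.
have -> : stable_slope x - stable_slope y =
  (stable_slope x - slope_approx m x) + (slope_approx m x - slope_approx m y)
  + (slope_approx m y - stable_slope y) by ring.
apply: (le_lt_trans (ler_normD _ _)); apply: (le_lt_trans (lerD (ler_normD _ _) (lexx _))).
lra.
Unshelve. all: by end_near. Qed.

Definition stable_line x : set (R * R) := [set a *: (stable_slope x, 1) | a in [set: R]].
Definition horizontal_line x : set (R * R) := [set a *: (1, 0) | a in [set: R]].

Lemma scale_pair (a b c : R) : a *: (b, c) = (a * b, a * c). Proof. by []. Qed.

(** Along the stable line the differential acts by the product of the contracting
    coefficients only, because the line field is invariant. *)
Lemma iter_stable m x (a : R) : S x ->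
  'd (iter m Phi) x (a *: (stable_slope x, 1)) =
  (a * ga_iter m x) *: (stable_slope (iter m Phi x), 1).
Proof.
move=> Sx; have D := is_diff_iter m Sx; rewrite diff_val !scale_pair /= !mulr1.
congr pair; last by rewrite mulrC.
suff : al_iter m x * stable_slope x + be_iter m x =
    ga_iter m x * stable_slope (iter m Phi x).
  by move=> E; rewrite -mulrA -E; ring.
elim: m {D} => [|m IH]; first by rewrite /= addr0.
have E := stable_slope_invariant (S_iter m Sx).
rewrite iterS /= -[RHS]mulrA [ga_iter m x * _]mulrC mulrA -E.
rewrite -[al _ * al_iter m x * _]mulrA addrA -mulrDr IH; ring.
Qed.

(** The stable line field is the limit of the graph transform, the unstable one is
    horizontal.  The constant combines the bound on the stable slope, which
    compares the norm with the second coordinate, and 1/r0, which compares rho with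
    the Euclidean norm. *)
Lemma skew_product_hyperbolic : uniformly_hyperbolic C P f S.
Proof.
have /andP[l0 l1] := l01; have nu0 : 0 < nu := lt_trans ltr01 nu_gt1.
split=> [x Sx m|].
  have D := is_diff_iter m Sx; split; first by have [] := D.
  have A0 := al_iter_neq0 m Sx; have G0 := ga_iter_neq0 m Sx.
  rewrite diff_val.
  exists (fun w => ((w.1 - be_iter m x / ga_iter m x * w.2) / al_iter m x,
                    w.2 / ga_iter m x)) => -[a b] /=;
    by congr pair; field; rewrite ?A0 ?G0.
exists stable_line, horizontal_line; split.
- move=> x Sx; split; [exists (stable_slope x, 1)|exists (1, 0)] => //.
    by apply/eqP => -[_ /eqP]; rewrite oner_eq0.
  by apply/eqP => -[/eqP]; rewrite oner_eq0.
- move=> x Sx; split.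
    apply/seteqP; split=> [w [[a _ <-] [b _]]|w ->]; last first.
      by split; exists 0 => //; rewrite scale0r.
    by rewrite !scale_pair => -[_]; rewrite mulr0 mulr1 => <-; rewrite mul0r.
  move=> [a b]; exists (b *: (stable_slope x, 1)), ((a - b * stable_slope x) *: (1, 0)).
  split; [by exists b|by exists (a - b * stable_slope x)|].
  by rewrite !scale_pair; congr pair; rewrite /=; ring.
- split=> x Sx.
    exists (fun y => (stable_slope y, 1)); split.
      by near=> y; split => //; apply/eqP => -[_ /eqP]; rewrite oner_eq0.
    exact: cvg_pair (stable_slope_continuous Sx) (cvg_cst (1 : R)).
  exists (fun y => (1, 0)); split; last exact: cvg_cst.
  by near=> y; split => //; apply/eqP => -[/eqP]; rewrite oner_eq0.
- move=> x Sx; have g0 := ga_neq0 Sx; have a0 := al_neq0 Sx; split.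
    have H a := iter_stable 1 a Sx; rewrite /= in H.
    apply/seteqP; split=> [_ [_ [a _ <-] <-]|_ [a _ <-]].
      by exists (a * (ga x * 1)) => //; rewrite -H.
    exists ((a / ga x) *: (stable_slope x, 1)); first by exists (a / ga x).
    by rewrite H mulr1 mulfVK.
  have D := dPhi Sx; rewrite diff_val.
  apply/seteqP; split=> [_ [_ [a _ <-] <-]|_ [a _ <-]].
    exists (al x * a) => //; rewrite !scale_pair /=; congr pair; ring.
  exists ((a / al x) *: (1, 0)); first by exists (a / al x).
  by rewrite !scale_pair /=; congr pair; field.
set E := K / (1 - l).
exists (Num.max l nu^-1), (1 + E + r0^-1); split.
- by rewrite lt_max l0 gt_max l1 invf_lt1.
- rewrite addr_gt0 ?invr_gt0 // ltr_pwDl // divr_ge0 ?subr_ge0 ?(ltW l1) //.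
  by rewrite divr_ge0 // exprn_ge0 // ltW.
- move=> x m Sx _; set mu := Num.max _ _; set A := 1 + E + _.
  have mu0 : 0 <= mu by rewrite le_max ltW.
  have Er : 0 <= E.
    by rewrite divr_ge0 ?subr_ge0 ?(ltW l1) // divr_ge0 // exprn_ge0 // ltW.
  have ir : 0 < r0^-1 by rewrite invr_gt0.
  split=> w.
    move=> [a _ <-]; rewrite iter_stable //.
    have : `|a| <= enorm (a *: (stable_slope x, 1)).
      by apply: le_trans (ler_norm2_enorm _); rewrite /= [a *: 1]mulr1.
    move: (enorm (a *: _)) => N ha.
    have hb := stable_slope_bound (S_iter m Sx); rewrite -/E in hb.
    have h1 : `|ga_iter m x| <= mu ^+ m.
      apply: (le_trans (ga_iter_le m Sx)); rewrite lerXn2r ?nnegrE ?(ltW l0) //.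
      by rewrite le_max lexx.
    apply: (le_trans (enorm_le _)); rewrite !scale_pair /= mulr1.
    move: (stable_slope _) hb => e hb; rewrite !normrM.
    have -> : `|a| * `|ga_iter m x| * `|e| + `|a| * `|ga_iter m x| =
      (`|e| + 1) * `|ga_iter m x| * `|a| by ring.
    apply: ler_pM => //.
    apply: ler_pM => //.
    rewrite /A; lra.
  have D := is_diff_iter m Sx; have -> : 'd (iter m Phi) x w =
    (al_iter m x * w.1 + be_iter m x * w.2, ga_iter m x * w.2) by rewrite diff_val.
  move=> [a _ []] _.
  rewrite [a *: _]mulr0 => /esym/eqP; rewrite mulf_eq0 (negPf (ga_iter_neq0 m Sx)) /=.
  move=> /eqP w0; rewrite w0 mulr0 addr0 mulr0.
  apply: (le_trans (enorm_le _)); rewrite w0 normr0 addr0.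
  apply: (le_trans _ (ler_wpM2l _ (ler_norm1_enorm _))); last first.
    by rewrite mulr_ge0 ?exprn_ge0 // !addr_ge0 // ltW.
  rewrite /= normrM mulrA -[leLHS]mul1r ler_wpM2r //.
  have h := al_iter_ge m Sx.
  apply: (@le_trans _ _ (r0^-1 * nu ^- m * (r0 * nu ^+ m))).
    by rewrite le_eqVlt; apply/orP; left; apply/eqP; field; rewrite expf_neq0 ?gt_eqF.
  apply: ler_pM => //.
  - by rewrite mulr_ge0 ?invr_ge0 ?exprn_ge0 // ltW.
  - by rewrite mulr_ge0 ?exprn_ge0 // ltW.
  apply: ler_pM.
  - exact: ltW.
  - by rewrite invr_ge0 exprn_ge0 // ltW.
  - by rewrite /A lerDr addr_ge0.
  rewrite -exprVn lerXn2r ?nnegrE ?invr_ge0 ?(ltW nu0) //.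
  by rewrite le_max lexx orbT.
Unshelve. all: by end_near. Qed.

End SkewProduct.

(** * Invariant sets without trapped orbits *)

Section Hyperbolicity.
Context {R : realType} (C : 'I_4 -> (R * R)%type) (f : R -> R) (l h : R).
Hypothesis FR : rect_frame C.
Hypothesis fl : contracting_law f l.
Hypothesis len_le1 : forall i, len C i <= 1.
Hypothesis ratio : forall i, len C i / len C (ordS i) <= h^-1.
Hypothesis tilde_gt0 : 0 < theta_tilde f.
Variable Nesc : nat.
Hypothesis escapes : forall a : R, Iangle a -> theta_tilde f < `|a| ->
  h^-1 < tan_sum f Nesc a.
Notation P := (hull C).
Notation Phi := (Phi C P f).
Implicit Types (i j : 'I_4) (x y : (R * R)%type) (b : branch) (m : nat).

Section InvariantSet.
Variable S : set (R * R).
Hypothesis Sinv : invariant_set C P f S.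
Hypothesis SM : S `<=` Mhat C P f.

Lemma invariant_live x : S x -> live C f x.
Proof. by move=> /SM/Mhat_live[]. Qed.

Lemma invariant_Phi x : S x -> S (Phi x).
Proof. by have [_ E] := Sinv; rewrite -{1}E => -[]. Qed.

(** Invariance includes S in D, so points of S have preimages with a full positive
    orbit, and total invariance puts these back in S. *)
Lemma invariant_pre x : S x -> exists2 y, S y & Phi y = x.
Proof.
have [SD E] := Sinv => Sx; have [y yl /= yx] := SD x Sx 1%N Logic.I.
by exists y => //; rewrite -E; split; [exact: (@live_dom _ _ f)|rewrite /= yx].
Qed.

Lemma invariant_image x : S x -> exists2 a, Iangle a & x.2 = f a.
Proof.
move=> Sx; have [y Sy <-] := invariant_pre Sx.
have [b [i h']] := live_aims FR (invariant_live Sy).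
exists (turn b - y.2); first by have [] := turn_opposite FR h'.
exact: (Phi2_aims f FR h').
Qed.

Lemma invariant_angle_le x : S x -> `|x.2| <= l * (pi / 2).
Proof.
move=> Sx; have [a Ia ->] := invariant_image Sx.
apply: (le_trans (law_contracts fl Ia)); have /andP[l0 _] := law_rate fl.
by rewrite ler_pM2l //; case/andP: (Iangle_norm Ia) => _ /ltW.
Qed.

(** A perpendicular ray crosses its channel forever, hence is trapped. *)
Lemma invariant_angle_neq0 x : S x -> x.2 != 0.
Proof.
move=> Sx; apply/eqP => x0; have /Mhat_live[xl] := SM Sx; apply.
apply/(T_across FR fl); split=> // m _.
have H : (iter m Phi x).2 = 0 /\ across C (iter m Phi x).
  elim: m => [|m [IH H]] /=.
    by split => //; have [_ [i [xi _ _]]] := live_aims FR xl; exists i; exact: perp_across.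
  have y0 : (Phi (iter m Phi x)).2 = 0.
    apply: oppr_inj; rewrite (Phi2_across f FR H) IH oppr0 f1_law ?(law0 fl) ?oppr0 //.
    exact: Iangle0.
  split => //.
  have [_ [i [yi _ _]]] := live_aims FR (live_iter FR fl m.+1 xl).
  by exists i; exact: perp_across.
by case: H.
Qed.

(** Along m crossings in the past the angle has shrunk by l^m from at most a right
    angle, so a nonzero angle allows only finitely many of them. *)
Lemma invariant_recent_turn x : S x ->
  exists m y, [/\ S y, theta_tilde f < `|y.2|, iter m Phi y = x &
    forall p, (p < m)%N -> across C (iter p Phi y)].
Proof.
move=> Sx; have /andP[l0 l1] := law_rate fl.
(* going m steps back, either some step was a passage between adjacent
   sides, or all of them were crossings *)
have dich m : (exists m y, [/\ S y, theta_tilde f < `|y.2|, iter m Phi y = x &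
    forall p, (p < m)%N -> across C (iter p Phi y)]) \/
  (exists2 y, S y & iter m Phi y = x /\
    forall p, (p < m)%N -> across C (iter p Phi y)).
  elim: m => [|m [IH|[y Sy [yx H]]]]; [by right; exists x|by left|].
  have [z Sz zy] := invariant_pre Sy.
  have [a|na] := pselect (across C z).
    right; exists z => //; split; first by rewrite iterSr zy.
    by move=> [|p] pm //; rewrite iterSr zy; exact: H.
  left; exists m, y; split => //; have [a Ia za] := invariant_image Sz.
  by rewrite -zy; exact: (adjacent_turn FR fl (invariant_live Sz) Ia za na).
have : l ^+ m * (l * (pi / 2)) @[m --> \oo] --> 0.
  rewrite -[X in _ --> X](mul0r (l * (pi / 2))); apply: cvgM; last exact: cvg_cst.
  by apply: cvg_expr; rewrite ger0_norm // ltW.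
have x0 : 0 < `|x.2| by rewrite normr_gt0 invariant_angle_neq0.
move=> /cvgrPdist_lt/(_ _ x0)[m _ /(_ m (leqnn m))].
rewrite sub0r normrN => /(le_lt_trans (ler_norm _)) hm.
have [//|[y Sy [yx H]]] := dich m.
have : `|x.2| <= l ^+ m * `|y.2|.
  rewrite -yx; elim: m H {hm yx} => [|m IH] H; first by rewrite mul1r.
  rewrite iterS exprS -mulrA.
  apply: le_trans (across_contracts FR fl (H m (ltnSn m))) _.
  by rewrite ler_wpM2l ?(ltW l0) // IH // => p pm; apply: H; rewrite ltnW.
move=> h1; have h2 : l ^+ m * `|y.2| <= l ^+ m * (l * (pi / 2)).
  by rewrite ler_wpM2l ?exprn_ge0 ?(ltW l0) // invariant_angle_le.
by have := le_lt_trans (le_trans h1 h2) hm; rewrite ltxx.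
Qed.

(** The last passage between adjacent sides lies at most Nesc crossings back, by the
    escape bound; the angle after it was beyond theta_tilde, and boundedly many
    iterations of [f1] keep it away from 0. *)
Lemma invariant_angle_ge : exists2 eps, 0 < eps & forall x, S x -> eps <= `|x.2|.
Proof.
have [eps e0 He] := iter_lower_bound fl Nesc tilde_gt0.
exists eps => // x Sx; have [m [y [Sy ty <- H]]] := invariant_recent_turn Sx.
have yl := invariant_live Sy; have [_ [_ [_ Iy _]]] := live_aims FR yl.
rewrite -normrN (across_run_angle FR H); apply: He.
- rewrite leqNgt; apply/negP => Nm.
  apply: (across_run_escapes FR fl ratio tilde_gt0 escapes yl ty) => p pN.
  by apply: H; exact: ltn_trans Nm.
- exact: IangleN.
- by rewrite normrN ltW.
Qed.

(** The entries of the Jacobian matrix, defined without reference to a branch so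
    that their continuity can be stated on the whole domain. *)
Definition d_ss x : R := ('d Phi x (1, 0)).1.
Definition d_st x : R := ('d Phi x (0, 1)).1.
Definition d_tt x : R := ('d Phi x (0, 1)).2.

Lemma aims_derivable b i x : aims C b i x -> derivable f (turn b - x.2) 1.
Proof. by move=> /(turn_opposite FR)[Ia _]; exact: law_derivable fl _ Ia. Qed.

Lemma d_aims b i x : aims C b i x ->
  [/\ d_ss x = slope b x.2, d_st x = shear C b i x
    & d_tt x = - derive1 f (turn b - x.2)].
Proof.
move=> h'; have D := is_diff_Phi FR h' (aims_derivable h').
by split; rewrite /d_ss /d_st /d_tt diff_val /= ?mulr1 ?mulr0 ?addr0 ?add0r.
Qed.

Lemma is_diff_d b i x : aims C b i x ->
  is_diff x Phi (fun w => (d_ss x * w.1 + d_st x * w.2, d_tt x * w.2)).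
Proof.
by move=> h'; have [-> -> ->] := d_aims h'; exact: is_diff_Phi (aims_derivable h').
Qed.

Lemma near_within_cvg (g g' : R * R -> R) x :
  (\forall y \near x, g' y = g y) -> g' y @[y --> x] --> g' x ->
  g y @[y --> within S (nbhs x)] --> g x.
Proof.
move=> E c; rewrite -(nbhs_singleton E).
apply: cvg_within_filter; apply: cvg_trans c.
by apply: near_eq_cvg; exact: E.
Qed.

Lemma cvg_snd_comp (g : R -> R) x : {for x.2, continuous g} ->
  g y.2 @[y --> x] --> g x.2.
Proof. by move=> c; apply: (cvg_comp _ _ (@cvg_snd _ _ (nbhs x.1) (nbhs x.2) _)); exact: c. Qed.

(** The branch formulas are continuous, and by [near_aims] they represent the
    Jacobian near the point. *)
Lemma aims_cvg b i x : aims C b i x ->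
  [/\ slope b y.2 @[y --> x] --> slope b x.2,
      shear C b i y @[y --> x] --> shear C b i x
    & - derive1 f (turn b - y.2) @[y --> x] --> - derive1 f (turn b - x.2)].
Proof.
move=> h'; have [_ hx _] := h'.
have c0 : cos x.2 != 0 by rewrite gt_eqF // cos_gt0_pihalf.
have cs : sin y.2 ^+ 2 @[y --> x] --> sin x.2 ^+ 2.
  by apply: cvgM; apply: cvg_snd_comp; exact: continuous_sin.
have cc : cos y.2 ^+ 2 @[y --> x] --> cos x.2 ^+ 2.
  by apply: cvgM; apply: cvg_snd_comp; exact: continuous_cos.
have ct : tan y.2 @[y --> x] --> tan x.2.
  by apply: cvg_snd_comp; exact: continuous_tan.
have c1 : y.1 @[y --> x] --> x.1 by exact: cvg_fst.
have t0 : b <> Across -> tan x.2 != 0.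
  move=> bA; have := aims_sin_neq0 FR h' bA.
  by rewrite (tanE c0) mulf_eq0 (negPf c0) orbF.
split.
- case: b {h'} t0 => t0 /=; first exact: cvg_cst.
    by apply: cvgN; apply: cvgV => //; exact: t0.
  by apply: cvgV => //; exact: t0.
- case: b h' t0 => h' t0 /=.
  + by apply: cvgN; apply: cvgM; [exact: cvg_cst|apply: cvgV; rewrite ?expf_neq0].
  + apply: cvgM; last by apply: cvgV; rewrite // expf_neq0 // (aims_sin_neq0 FR h').
    by apply: cvgB; [apply: cvgB => //; exact: cvg_cst|exact: cvg_cst].
  + apply: cvgN; apply: cvgM.
      by apply: cvgB => //; exact: cvg_cst.
    by apply: cvgV; rewrite // expf_neq0 // (aims_sin_neq0 FR h').
- apply: cvgN; apply: (@cvg_comp _ _ _ (fun y : R * R => turn b - y.2) (derive1 f)).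
    by apply: cvgB; [exact: cvg_cst|exact: cvg_snd].
  have [Ia _] := turn_opposite FR h'; exact: law_continuous fl _ Ia.
Qed.

Lemma cos_bound_angle (a c : R) : `|a| <= c -> c <= pi -> cos c <= cos a.
Proof.
move=> ac cp; rewrite -(cos_norm a); move: ac; rewrite le_eqVlt => /predU1P[-> //|ac].
have a0 := normr_ge0 a.
by rewrite ltW // ltr_cos ?in_itv /=; try (apply/andP; split); lra.
Qed.

(** The criterion applies with rho = cos theta: the lower bound on the angle gives
    the expansion factor through [cos_expansion], and it bounds the shear; the
    upper bound l pi/2 on the angle keeps rho away from 0. *)
Lemma invariant_hyperbolic : uniformly_hyperbolic C P f S.
Proof.
have [eps e0 He] := invariant_angle_ge.
have [nu nu1 Hnu] := cos_expansion fl e0.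
have /andP[l0 l1] := law_rate fl; have p1 := pihalf_ge1 R.
have lp : 0 < l * (pi / 2) < pi / 2.
  by rewrite mulr_gt0 //=; [rewrite -[ltRHS]mul1r ltr_pM2r //|]; lra.
(* eps may exceed a right angle when S is empty, hence the minimum with 1 *)
pose r0 := cos (l * (pi / 2)); pose s0 := sin (Num.min eps 1).
have r00 : 0 < r0 by apply: cos_gt0_pihalf; case/andP: lp => ? ?; apply/andP; split; lra.
have m1 : 0 < Num.min eps 1 <= 1 by rewrite lt_min e0 ltr01 ge_min lexx orbT.
have s00 : 0 < s0 by apply: sin_gt0_pi; case/andP: m1 => ? ?; apply/andP; split; lra.
have cosS x : S x -> r0 <= cos x.2.
  move=> Sx; apply: cos_bound_angle; first exact: invariant_angle_le.
  by case/andP: lp => ? ?; lra.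
have sinS x : S x -> s0 <= `|sin x.2|.
  move=> Sx; have hx := He x Sx.
  have Ix : Iangle x.2 by have [b [i []]] := live_aims FR (invariant_live Sx).
  have /andP[_ xp] := Iangle_norm Ix.
  have -> : `|sin x.2| = sin `|x.2|.
    case: (ltgtP x.2 0) => x0.
    - rewrite !ltr0_norm ?sinN // -oppr_gt0 -sinN sin_gt0_pihalf //.
      by rewrite oppr_gt0 x0; rewrite ltr0_norm in xp.
    - rewrite !gtr0_norm // sin_gt0_pihalf //.
      by rewrite x0; rewrite gtr0_norm in xp.
    - by rewrite x0 sin0 !normr0 sin0.
  have : Num.min eps 1 <= `|x.2| by rewrite ge_min hx.
  rewrite /s0; move: (Num.min _ _) m1 => c /andP[c0 c1].
  rewrite le_eqVlt => /predU1P[-> //|cx]; rewrite ltW //.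
  by rewrite ltr_sin ?in_itv /=; try (apply/andP; split); lra.
have loc x : S x -> exists b i, aims C b i x.
  by move=> /invariant_live/(live_aims FR).
apply: (@skew_product_hyperbolic _ _ C P f S d_ss d_st d_tt (fun x => cos x.2)
  r0 nu l ((s0 * r0)^-1 + (r0 ^+ 2)^-1)) => //.
- exact: invariant_Phi.
- by move=> x /loc[b [i h']]; exact: is_diff_d h'.
- move=> x Sx; have [b [i h']] := loc x Sx; have [c _ _] := aims_cvg h'.
  apply: (near_within_cvg _ c); apply: filterS (near_aims h') => y hy.
  by have [] := d_aims hy.
- move=> x Sx; have [b [i h']] := loc x Sx; have [_ c _] := aims_cvg h'.
  apply: (near_within_cvg _ c); apply: filterS (near_aims h') => y hy.
  by have [] := d_aims hy.
- move=> x Sx; have [b [i h']] := loc x Sx; have [_ _ c] := aims_cvg h'.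
  apply: (near_within_cvg _ c); apply: filterS (near_aims h') => y hy.
  by have [] := d_aims hy.
- move=> x Sx; have [b [i h']] := loc x Sx; have [-> _ _] := d_aims h'.
  have [_ hx _] := h'; have [Ia _] := turn_opposite FR h'.
  by rewrite -normr_gt0 (slope_norm FR h') divr_gt0 // cos_gt0_pihalf.
- move=> x Sx; have [b [i h']] := loc x Sx; have [_ _ ->] := d_aims h'.
  have [Ia _] := turn_opposite FR h'.
  by rewrite oppr_eq0 gt_eqF // (law_derive_gt0 fl).
- by move=> x Sx; rewrite cosS // cos_le1.
- move=> x Sx; have [b [i h']] := loc x Sx; have [-> _ _] := d_aims h'.
  have [_ hx _] := h'; have [Ia _] := turn_opposite FR h'.
  have ca := cos_gt0_pihalf Ia; have cx := cos_gt0_pihalf hx.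
  rewrite (slope_norm FR h'); have := Hnu _ Ia; rewrite -(Phi2_aims f FR h').
  have e1 : eps <= `|turn b - x.2|.
    apply: le_trans (He _ (invariant_Phi Sx)) _; rewrite (Phi2_aims f FR h').
    by apply: (le_trans (law_contracts fl Ia)); rewrite ler_piMl // ltW.
  move=> /(_ e1) H; rewrite mulrAC ler_pdivlMr // mulrAC mulrC ler_pM2l //.
- by rewrite l0.
- move=> x Sx; have [b [i h']] := loc x Sx; have [_ _ ->] := d_aims h'.
  have [Ia _] := turn_opposite FR h'.
  by rewrite normrN gtr0_norm ?(law_derive_gt0 fl) // (law_derive_le fl).
- by rewrite addr_ge0 // invr_ge0 ?sqr_ge0 // mulr_ge0 // ltW.
- move=> x Sx; have [b [i h']] := loc x Sx; have [_ -> _] := d_aims h'.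
  by apply: shear_bound; rewrite ?s00 ?r00 ?sinS ?cosS.
Qed.

End InvariantSet.
End Hyperbolicity.

Theorem corollary8p9 (R : realType) (h : R) (hh : 0 < h <= 1)
  (C : 'I_4 -> (R * R)%type)
  (hC : is_rectangle C 1 h \/ is_rectangle C h 1)
  (k : nat) (hk : (1 <= k)%N) (f : R -> R)
  (hf : reflection_law k f)
  (hf' : forall a, Iangle a -> 0 < derive1 f a)
  (theta_minus theta_plus : R)
  (hminus : - (pi / 2) < theta_minus < 0)
  (hplus : 0 < theta_plus < pi / 2)
  (sol_minus : solves_tan_series f h theta_minus)
  (sol_plus : solves_tan_series f h theta_plus)
  (htilde : Num.max (- theta_minus) theta_plus < theta_tilde f) :
  let P := hull C in
  [/\ Phi C P f @` Mhat C P f `<=` Mhat C P f,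
      forall S : set (R * R), invariant_set C P f S -> S `<=` Mhat C P f ->
        uniformly_hyperbolic C P f S
    & basin C P f (period2 C P f) = T C P f].
Proof.
move=> P; have /andP[h0 h1] := hh.
have [l fl] := reflection_law_contracting hk hf hf'.
have [FR Hlen] : rect_frame C /\ forall i, (len C i <= 1) /\
    len C i / len C (ordS i) <= h^-1.
  have hi : 1 <= h^-1 by rewrite invf_ge1.
  have hle : h / 1 <= h^-1 by rewrite divr1 (le_trans h1).
  have hge : 1 / h <= h^-1 by rewrite mul1r.
  case: hC => /rectangle_frame[] // FR H; split=> // i;
    by case: (H i) => -[-> ->]; rewrite ?h1 ?lexx.
have t0 : 0 < theta_tilde f.
  by apply: lt_trans htilde; rewrite lt_max orbC; case/andP: hplus => ->.
(* any angle that occurs after a passage to the right is an upper bound;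
   here the ray left the previous side at angle f(pi / 4) *)
have tp : theta_tilde f < pi / 2.
  have Iq : Iangle (pi / 4 : R).
    by have := pi_gt0 R => p0; apply/andP; split; lra.
  have fq : 0 < f (pi / 4) by apply: (law_gt0 fl) => //; have := pi_gt0 R; lra.
  have [/(_ fq) lt_t _] := theta_tilde_turn fl Iq.
  have Ic : Iangle (pi / 2 - f (pi / 4)).
    have /andP[_ b] := law_Iangle fl Iq; have := pi_gt0 R => p0.
    by apply/andP; split; lra.
  by apply: (lt_trans lt_t); case/andP: (law_Iangle fl Ic).
have [Nesc escapes] : exists N, forall a : R, Iangle a -> theta_tilde f < `|a| ->
    h^-1 < tan_sum f N a.
  case/andP: hminus => m1 m2; case/andP: hplus => p1 p2.
  apply: (@escape R f l fl h theta_minus theta_plus) => //.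
  - by apply/andP; split => //; rewrite (lt_trans m2) // divr_gt0 // pi_gt0.
  - by apply/andP; split => //; rewrite (lt_trans _ p1) // oppr_lt0 divr_gt0 // pi_gt0.
  - by rewrite m2.
  - by rewrite htilde.
have ratio i := (Hlen i).2; have len_le1 i := (Hlen i).1.
split.
- exact: (Mhat_forward FR fl ratio t0 escapes).
- move=> S Sinv SM.
  exact: (invariant_hyperbolic FR fl len_le1 ratio t0 escapes Sinv SM).
- exact: (basin_T FR fl ratio t0 escapes).
Qed.
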